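(* Let $\Omega\subset\mathbb C^m$ be a bounded domain, $\mathcal H\subseteq\mathcal O(\Omega)$ an analytic Hilbert module, $\mathcal I\subseteq\mathbb C[z_1,\dots,z_m]$ an ideal, $\mathcal M=[\mathcal I]$ its closure in $\mathcal H$, $K$ the reproducing kernel of $\mathcal M$, and $\mathcal S=\mathcal S^{\mathcal M}$ the associated coherent sheaf on $\Omega$, equipped with the canonical hermitian structure described in the context. Then $\mathcal S$ is a holomorphic hermitian sheaf (i.e. this hermitian structure is smooth); that is, the following holds. Fix $w_0\in\Omega$, a minimal set of generators $g_1^0,\dots,g_d^0$ of the stalk $\mathcal S_{w_0}$, and a sufficiently small open neighbourhood $\Omega_0$ of $w_0$ on which $g^0_1,\dots,g^0_d$ are defined and generate $\mathcal S_w$ for every $w\in\Omega_0$, and on which there are anti-holomorphic maps $w\mapsto K^{(i)}_{w_0}(\cdot,w)\in\mathcal M$, $1\le i\le d$, linearly independent at each $w\in\Omega_0$, with $K(\cdot,w)=\sum_{i=1}^d\overline{g_i^0(w)}K^{(i)}_{w_0}(\cdot,w)$, $w\in\Omega_0$. Put $\mathbb H(w)=\big(\langle K^{(i)}_{w_0}(\cdot,w),K^{(j)}_{w_0}(\cdot,w)\rangle\big)_{i,j=1}^d$. For $w\in\Omega_0$, let $s_1^{(w)},\dots,s_e^{(w)}$ be a minimal set of generators of $\mathcal S_w$ ($e$ depends on $w$), let $K^{(1)}_w(\cdot,u),\dots,K_w^{(e)}(\cdot,u)$ be linearly independent vectors of $\mathcal M$, anti-holomorphic in $u$ near $w$, with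 $K(\cdot,u)=\sum_{j=1}^e\overline{s_j^{(w)}(u)}K^{(j)}_w(\cdot,u)$, and let $G$ be an $e\times d$ matrix with entries in $\mathcal O_w$ such that $(s_1^{(w)}(u),\dots,s_e^{(w)}(u))\,G(u)=(g_1^0(u),\dots,g_d^0(u))$ for $u$ near $w$. Then $$\overline{G(w)}\,\mathbb H(w)\,G(w)^\dagger=\big(\langle K^{(i)}_w(\cdot,w),K^{(j)}_w(\cdot,w)\rangle\big)_{i,j=1}^e,\qquad w\in\Omega_0,$$ where $G(w)^\dagger$ is the transpose of $G(w)$.
   Context: An analytic Hilbert module over $\mathbb C[z_1,\dots,z_m]$ is a Hilbert space $\mathcal H\subseteq\mathcal O(\Omega)$ (holomorphic functions on the connected open set $\Omega$) possessing a reproducing kernel (holomorphic in the first variable, anti-holomorphic in the second), such that pointwise multiplication by every polynomial is bounded on $\mathcal H$, and such that $\mathbb C[z_1,\dots,z_m]$ is contained and dense in $\mathcal H$. The sheaf $\mathcal S^{\mathcal M}$ is the subsheaf of the sheaf of holomorphic functions on $\Omega$ whose stalk at $w$ is the ideal $\mathcal S^{\mathcal M}_w$ of $\mathcal O_w$ generated by the germs at $w$ of functions in $\mathcal M$; it is coherent. For $w\in\Omega$, $\mathcal O_w$ is the ring of germs of holomorphic functions at $w$, $\mathfrak m_w$ its maximal ideal, and, for an analytic sheaf $\mathcal S$, $\overline{\mathcal S}_w=\mathcal S_w/\mathfrak m_w\mathcal S_w$, which is finite dimensional if $\mathcal S$ is coherent; $\overline{\mathcal O}^{\,n}_w\cong\mathbb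 C^n$. A hermitian structure on a coherent sheaf $\mathcal S$ is an assignment of an inner product on each $\overline{\mathcal S}_w$, $w\in\Omega$. It is smooth if each $w_0\in\Omega$ has an open neighbourhood $U$, with an exact sequence $\mathcal O^n_U\xrightarrow{\varphi}\mathcal S_U\to0$ and a smoothly varying family of inner products on $\overline{\mathcal O}^{\,n}_w\cong\mathbb C^n$, $w\in U$, such that the inner product on $\overline{\mathcal S}_w$ is the quotient inner product under $\overline\varphi_w:\overline{\mathcal O}^{\,n}_w\to\overline{\mathcal S}_w\to0$. A coherent sheaf with a smooth hermitian structure is called a holomorphic hermitian sheaf. Known facts (decomposition theorem of Biswas–Misra–Putinar): if $g_1,\dots,g_d$ is a minimal set of generators of $\mathcal S^{\mathcal M}_{w_0}$, then on some neighbourhood of $w_0$ there are anti-holomorphic $\mathcal M$-valued maps $K_{w_0}^{(1)},\dots,K_{w_0}^{(d)}$, linearly independent at each point near $w_0$, with $K(\cdot,w)=\sum_i\overline{g_i(w)}K_{w_0}^{(i)}(\cdot,w)$; the vectors $K_{w_0}^{(i)}(\cdot,w_0)$ are uniquely determined by $g_1,\dots,g_d$. Canonical hermitian structure on $\mathcal S^{\mathcal M}$: for $w_0\in\Omega$ and a minimal set of generators $g_1,\dots,g_d$ of $\mathcal S_{w_0}$, identify $\overline{\mathcal S}_{w_0}$ with $\mathbb C^d$ via $[\sum_i h_ig_i]\mapsto(h_1(w_0),\dots,h_d(w_0))$, let $H(w_0)=(\langle K_{w_0}^{(i)}(\cdot,w_0),K_{w_0}^{(j)}(\cdot,w_0)\rangle)_{i,j=1}^d$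 (a positive definite matrix), and give $\mathbb C^d$ the inner product $\langle\alpha,\beta\rangle=\sum_{i,j}(H(w_0)^{-1})_{ij}\alpha_i\overline{\beta_j}$. The resulting inner product on $\overline{\mathcal S}_{w_0}$ does not depend on the choice of minimal generators. For the smoothness statement near $w_0$, the presentation is $\varphi:\mathcal O^d\to\mathcal S$, $(\alpha_1,\dots,\alpha_d)\mapsto\sum_i\alpha_ig_i^0$, with the inner product on $\overline{\mathcal O}^{\,d}_w\cong\mathbb C^d$ defined in the same way by $\mathbb H(w)^{-1}$. *)

(* Defs.v *)
From HB Require Import structures.
From mathcomp Require Import all_boot all_order all_algebra.
From mathcomp Require Import all_classical all_reals all_analysis.
From mathcomp Require Import complex.
From mathcomp Require mpoly.
Export (canonicals) mpoly.
Set Implicit Arguments.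
Unset Strict Implicit.
Unset Printing Implicit Defensive.
Import Order.TTheory GRing.Theory Num.Theory.
Import numFieldNormedType.Exports.
Local Open Scope ring_scope.
Local Open Scope classical_set_scope.
Local Open Scope complex_scope.

(* The library equips only abstract numeric fields with the topology of their
   norm; this is the same structure on the concrete field R[i]. *)
#[warnings="-redundant-canonical-projection"]
HB.instance Definition _ (R : rcfType) := NormedModule.copy R[i] R[i]^o.

(* Points of C^m are row vectors over R[i]. A germ at w is represented by a
   total function C^m -> C, of which only the values near w matter. *)

Section Holomorphic.
Context {R : realType} {m : nat} {W : normedModType R[i]}.
Local Notation Cm := 'rV[R[i]]_m.

(* `differentiable` is Frechet differentiability over the scalar field R[i],
   that is, complex differentiability. It constrains f near z, so that the
   definitions on a set U are meant for U open. *)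
Definition holomorphic (U : set Cm) (f : Cm -> W) : Prop :=
  forall z, U z -> differentiable f z.

Definition holomorphic_near (w : Cm) (f : Cm -> W) : Prop :=
  \forall u \near w, differentiable f u.

Definition conjv (z : Cm) : Cm := map_mx Num.conj z.

Definition antiholomorphic (U : set Cm) (f : Cm -> W) : Prop :=
  forall z, U z -> differentiable (f \o conjv) (conjv z).

End Holomorphic.

Section Smooth.
Context {R : realType}.

Fixpoint Ck {E F : normedModType R} (k : nat) (U : set E) (f : E -> F) : Prop :=
  (forall x, U x -> {for x, continuous f}) /\
  if k is k'.+1 then
    forall v, (forall x, U x -> derivable f x v) /\ Ck k' U ('D_v f)
  else True.

Definition of_real_coords {m : nat} (p : 'rV[R]_m * 'rV[R]_m) : 'rV[R[i]]_m :=
  \row_j (p.1 0 j +i* p.2 0 j).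

(* C^infinity in the 2m real coordinates. *)
Definition smooth {m : nat} (U : set 'rV[R[i]]_m) (f : 'rV[R[i]]_m -> R[i]) :
    Prop :=
  forall k : nat,
    Ck k (of_real_coords @^-1` U) (fun p => complex.Re (f (of_real_coords p))) /\
    Ck k (of_real_coords @^-1` U) (fun p => complex.Im (f (of_real_coords p))).

End Smooth.

Section IdealSheaf.
Context {R : realType} {m : nat}.
Local Notation C := R[i].
Local Notation Cm := 'rV[C]_m.
Local Notation fn := (Cm -> C).

(* The ideal of O_w generated by the germs at w of the members of F. *)
Definition germ_ideal (w : Cm) (F : set fn) : set fn :=
  [set f | exists n (a g : 'I_n -> fn),
    [/\ forall i, holomorphic_near w (a i),
        forall i, F (g i) &
        \forall u \near w, f u = \sum_i a i u * g i u]].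

(* m_w I, for an ideal I of O_w. *)
Definition max_ideal_mul (w : Cm) (I : set fn) : set fn :=
  [set f | exists n (a g : 'I_n -> fn),
    [/\ forall i, holomorphic_near w (a i) /\ a i w = 0,
        forall i, I (g i) &
        \forall u \near w, f u = \sum_i a i u * g i u]].

(* A subsheaf of ideals of O is given by its stalks S w. *)
Implicit Type S : Cm -> set fn.

Definition is_section S (U : set Cm) (f : fn) : Prop :=
  holomorphic U f /\ forall w, U w -> S w f.

Definition generators S (w : Cm) (n : nat) (g : 'I_n -> fn) : Prop :=
  S w = germ_ideal w (range g).

Definition minimal_generators S (w : Cm) (n : nat) (g : 'I_n -> fn) : Prop :=
  generators S w g /\
  forall D : set 'I_n, D `<` [set: 'I_n] -> S w <> germ_ideal w (g @` D).

Definition finite_type (Omega : set Cm) S : Prop :=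
  forall w0, Omega w0 ->
    exists U n (g : 'I_n -> fn),
      [/\ open_nbhs w0 U, U `<=` Omega,
          forall i, is_section S U (g i) &
          forall w, U w -> generators S w g].

Definition finite_type_relations (Omega : set Cm) S : Prop :=
  forall (U : set Cm) n (s : 'I_n -> fn),
    open U -> U `<=` Omega -> (forall i, is_section S U (s i)) ->
  forall w0, U w0 ->
    exists U' k (r : 'I_k -> 'I_n -> fn),
      [/\ open_nbhs w0 U', U' `<=` U,
          forall l i, holomorphic U' (r l i),
          forall l w, U' w -> \sum_i r l i w * s i w = 0 &
          forall w (a : 'I_n -> fn), U' w ->
            (forall i, holomorphic_near w (a i)) ->
            (\forall u \near w, \sum_i a i u * s i u = 0) ->
          exists b : 'I_k -> fn,
            (forall l, holomorphic_near w (b l)) /\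
            \forall u \near w, forall i, a i u = \sum_l b l u * r l i u].

Definition coherent (Omega : set Cm) S : Prop :=
  finite_type Omega S /\ finite_type_relations Omega S.

(* An inner product on S_w / m_w S_w, as a form on S_w: the third clause makes
   it descend to the quotient, the fourth is definiteness there. Two
   representatives of a germ differ by an element of m_w S_w. *)
Definition fibre_inner_product S (w : Cm) (h : fn -> fn -> C) : Prop :=
  [/\ forall (c : C) (f g k : fn), S w f -> S w g -> S w k ->
        h (fun u => c * f u + g u) k = c * h f k + h g k,
      forall f g, S w f -> S w g -> h g f = Num.conj (h f g),
      forall f g, max_ideal_mul w (S w) f -> S w g -> h f g = 0 &
      forall f, S w f -> ~ max_ideal_mul w (S w) f -> 0 < h f f].

(* `form Num.conj P a b` is \sum_(i, j) P i j * a i * (b j)^*. *)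
Definition posdef (n : nat) (P : 'M[C]_n) : Prop :=
  (forall a b : 'rV[C]_n,
     form Num.conj P b a = Num.conj (form Num.conj P a b)) /\
  (forall a : 'rV[C]_n, a != 0 -> 0 < form Num.conj P a a).

(* Under O_w^n / m_w O_w^n = C^n, the class of a in C^n is that of the constant
   germs, and the morphism induced by (a_i) |-> \sum_i a_i g_i sends it to the
   class of the following germ. *)
Definition presentation (n : nat) (g : 'I_n -> fn) (a : 'rV[C]_n) : fn :=
  fun u => \sum_i a 0 i * g i u.

(* h is the quotient of the inner product P: the induced map is isometric on the
   orthogonal complement of its kernel. *)
Definition quotient_inner_product S (w : Cm) (n : nat) (g : 'I_n -> fn)
    (P : 'M[C]_n) (h : fn -> fn -> C) : Prop :=
  let perp_kernel (a : 'rV[C]_n) :=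
    forall c, max_ideal_mul w (S w) (presentation g c) ->
      form Num.conj P a c = 0 in
  forall a b, perp_kernel a -> perp_kernel b ->
    h (presentation g a) (presentation g b) = form Num.conj P a b.

(* A morphism O_U^n -> S_U is given by the n sections that are the images of the
   standard basis; it is onto when they generate every stalk over U. *)
Definition smooth_hermitian (Omega : set Cm) S (h : Cm -> fn -> fn -> C) :
    Prop :=
  forall w0, Omega w0 ->
    exists U n (g : 'I_n -> fn) (P : Cm -> 'M[C]_n),
      [/\ open_nbhs w0 U /\ U `<=` Omega,
          forall i, is_section S U (g i),
          forall w, U w -> generators S w g,
          forall i j, smooth U (fun w => P w i j) &
          forall w, U w ->
            posdef (P w) /\ quotient_inner_product S w g (P w) (h w)].

Definition holomorphic_hermitian_sheaf (Omega : set Cm) S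
    (h : Cm -> fn -> fn -> C) : Prop :=
  [/\ coherent Omega S,
      forall w, Omega w -> fibre_inner_product S w (h w) &
      smooth_hermitian Omega S h].

End IdealSheaf.

Section HilbertModule.
Context {R : realType} {m : nat}.
Local Notation C := R[i].
Local Notation Cm := 'rV[C]_m.
Local Notation poly := (mpoly.mpoly m C).

Definition evalp (p : poly) (z : Cm) : C := mpoly.meval (z 0) p.

(* Not the library's idealr_closed, which excludes the unit ideal. *)
Definition poly_ideal (I : set poly) : Prop :=
  [/\ I 0, forall p q, I p -> I q -> I (p + q) &
      forall p q, I q -> I (p * q)].

Definition bounded_domain (Omega : set Cm) : Prop :=
  [/\ Omega !=set0, open Omega, connected Omega & bounded_set Omega].

Context {V : completeNormedModType C} (dot : {dot V for @Num.conj C}).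
(* The space of functions is V, f in V being the function ev f on Omega. *)
Context (ev : V -> Cm -> C).

Definition represents (Omega : set Cm) (f : V) (p : poly) : Prop :=
  forall z, Omega z -> ev f z = evalp p z.

Record analytic_hilbert_module (Omega : set Cm) : Prop := {
  ahm_norm : forall f, `|f| ^+ 2 = dot f f;
  ahm_linear : forall (c : C) f g z, Omega z ->
    ev (c *: f + g) z = c * ev f z + ev g z;
  ahm_injective : forall f, (forall z, Omega z -> ev f z = 0) -> f = 0;
  ahm_holomorphic : forall f, holomorphic Omega (ev f);
  ahm_kernel : exists k : Cm -> V,
    [/\ forall f w, Omega w -> ev f w = dot f (k w),
        forall w, Omega w -> holomorphic Omega (ev (k w)) &
        forall z, Omega z -> antiholomorphic Omega (fun w => ev (k w) z)];
  ahm_mul : forall p : poly, exists T : {linear V -> V},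
    continuous T /\ forall f z, Omega z -> ev (T f) z = evalp p z * ev f z;
  ahm_poly : forall p : poly, exists f, represents Omega f p;
  ahm_dense : dense [set f | exists p, represents Omega f p]
}.

Definition ideal_closure (Omega : set Cm) (I : set poly) : set V :=
  closure [set f | exists2 p, I p & represents Omega f p].

Definition reproducing_kernel (Omega : set Cm) (M : set V) (K : Cm -> V) :
    Prop :=
  forall w, Omega w -> M (K w) /\ forall f, M f -> ev f w = dot f (K w).

Definition module_sheaf (M : set V) (w : Cm) : set (Cm -> C) :=
  germ_ideal w [set ev f | f in M].

Definition lin_indep (n : nat) (v : 'I_n -> V) : Prop :=
  forall c : 'I_n -> C, \sum_i c i *: v i = 0 -> forall i, c i = 0.

Definition gram (n : nat) (v : 'I_n -> V) : 'M[C]_n :=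
  \matrix_(i, j) dot (v i) (v j).

Definition kernel_decomposition (M : set V) (K : Cm -> V) (U : set Cm) (d : nat)
    (g : 'I_d -> Cm -> C) (Kd : 'I_d -> Cm -> V) : Prop :=
  [/\ forall i, holomorphic U (g i),
      forall i, antiholomorphic U (Kd i),
      forall i u, U u -> M (Kd i u),
      forall u, U u -> lin_indep (Kd ^~ u) &
      forall u, U u -> K u = \sum_i Num.conj (g i u) *: Kd i u].

(* At each w the inner product is the one built from some minimal generators at w
   and their decomposition of the kernel; every other choice gives the same one,
   so it is enough to ask for one choice. *)
Definition canonical_hermitian (Omega : set Cm) (M : set V) (K : Cm -> V)
    (h : Cm -> (Cm -> C) -> (Cm -> C) -> C) : Prop :=
  forall w, Omega w ->
    exists U d (g : 'I_d -> Cm -> C) (Kd : 'I_d -> Cm -> V),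
      [/\ open_nbhs w U /\ U `<=` Omega,
          minimal_generators (module_sheaf M) w g,
          kernel_decomposition M K U g Kd &
          forall (a b : 'I_d -> Cm -> C) (f1 f2 : Cm -> C),
            (forall i, holomorphic_near w (a i)) ->
            (forall i, holomorphic_near w (b i)) ->
            (\forall u \near w, f1 u = \sum_i a i u * g i u) ->
            (\forall u \near w, f2 u = \sum_i b i u * g i u) ->
            h w f1 f2 = form Num.conj (invmx (gram (Kd ^~ w)))
                          (\row_i a i w) (\row_i b i w)].

End HilbertModule.

(* Main.v *)
Require Import Defs.
From HB Require Import structures.
From mathcomp Require Import all_boot all_order all_algebra.
From mathcomp Require Import all_classical all_reals all_analysis.
From mathcomp Require Import complex.
From mathcomp Require Import ring lra.
From mathcomp Require mpoly.
Set Implicit Arguments.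
Unset Strict Implicit.
Unset Printing Implicit Defensive.
Import Order.TTheory GRing.Theory Num.Theory.
Import numFieldNormedType.Exports.
Local Open Scope ring_scope.
Local Open Scope classical_set_scope.
Local Open Scope complex_scope.

(** The canonical inner product on the fibre at [w] is the quotient of the norm
    of [M]: if [g] generates near [w] and K(., u) is the sum of the
    conj (g_i u) K_i(., u), then each [f] in [M] is the sum of the functions
    <f, K_i(., u)> g_i(u), so its class in the fibre has the coordinates
    <f, K_i(., w)>, and the quotient norm on C^d is given by the inverse of the
    Gram matrix of the vectors K_i(., w).  Everything else measures how this
    description changes with the generators and with the point.

    Change of generators.  Suppose that [s] is minimal at [w] and s G = g.
    Substituting g = s G in the decomposition of K along [g] gives a
    decomposition along [s], whose vectors are the sums of the
    conj (G_ji) K_i.  Pairing the difference of two decompositions along [s]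
    with a fixed vector gives a holomorphic relation between the s_j, and by
    minimality the coefficients of a relation vanish at [w]
    ([minimal_generators_relation]): a unit coefficient would make a generator
    superfluous.  So the two families of vectors agree at [w]
    ([decomposition_change]), and taking Gram matrices gives the displayed
    formula conj G H G^T ([gram_change]).

    The quotient.  Generators minimal at [w0] still generate near [w0], by
    finite type, but need not be minimal there.  At such a point the fibre is
    C^e, the presentation is a |-> a G^T, and a vector orthogonal to the kernel
    for H^-1 has the form x (conj G) H; on such vectors both inner products are
    x (conj G H G^T) y^*, by the change of generators ([quotient_form]).

    Smoothness.  The hypotheses only say that the K_i are complex
    differentiable at each point after conjugation, so the entries of the
    inverse Gram matrix have to be shown infinitely differentiable from there.
    Polarising, (z, v) |-> <K_i(conj z), K_j(v)> is holomorphic in 2m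
    variables, so are the entries of the inverse matrix, and the function
    wanted is the restriction to the real subspace z = conj v
    ([smooth_invmx_gram]).  It therefore suffices that a directional derivative
    of a holomorphic function is again holomorphic ([gateaux_holo_derive]),
    which follows from [goursat] through Cauchy's formula on a square
    ([cauchy_contour_derive]): the formula bounds the derivatives locally,
    hence makes the function, then its derivatives, locally Lipschitz, and
    finally gives the difference quotients of the derivatives a limit. *)

(** * Real-valued norms and limits in R[i] *)

Section ComplexBasics.
Context {R : realType}.
Local Notation C := R[i].
Implicit Types z w : C.

(** The norm of R[i] takes its values in R[i]; estimates are made with this
    real-valued version, for which real arithmetic is available. *)
Definition cabs (z : C) : R := Normc.normc z.
Arguments cabs : simpl never.

Lemma cabsE z : `|z| = (cabs z)%:C. Proof. by []. Qed.

Lemma cabs_ge0 z : 0 <= cabs z.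
Proof. by rewrite -lecR -cabsE; exact: normr_ge0. Qed.

Lemma cabsD z w : cabs (z + w) <= cabs z + cabs w.
Proof. exact: (@le_normcD R). Qed.

Lemma cabsN z : cabs (- z) = cabs z. Proof. exact: (@normcN R). Qed.

Lemma cabsB z w : cabs (z - w) <= cabs z + cabs w.
Proof. by rewrite -(cabsN w) cabsD. Qed.

Lemma cabs_distC z w : cabs (z - w) = cabs (w - z).
Proof. by rewrite -cabsN opprB. Qed.

Lemma cabsM z w : cabs (z * w) = cabs z * cabs w.
Proof. exact: Normc.normcM. Qed.

Lemma cabsV z : cabs z^-1 = (cabs z)^-1.
Proof. exact: Normc.normcV. Qed.

Lemma cabsX z n : cabs (z ^+ n) = cabs z ^+ n.
Proof.
by elim: n => [|n IH]; rewrite ?exprS ?cabsM ?IH// !expr0 /cabs Normc.normc1.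
Qed.

Lemma cabs0 : cabs 0 = 0. Proof. exact: Normc.normc0. Qed.

Lemma cabs_real (k : R) : cabs k%:C = `|k|.
Proof. by rewrite [cabs _]/(Normc.normc _) /= expr0n /= addr0 sqrtr_sqr. Qed.

Lemma cabs_i : cabs 'i = 1.
Proof. by rewrite [cabs _]/(Normc.normc _) /= expr0n /= add0r expr1n sqrtr1. Qed.

Lemma cabs_eq0 z : (cabs z == 0) = (z == 0).
Proof.
by apply/eqP/eqP => [/Normc.eq0_normc//|->]; exact: cabs0.
Qed.

Lemma cabs_gt0 z : (0 < cabs z) = (z != 0).
Proof. by rewrite lt_def cabs_ge0 andbT cabs_eq0. Qed.

Lemma Re_le_cabs z : `|complex.Re z| <= cabs z.
Proof. by rewrite -lecR -cabsE normc_ge_Re. Qed.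

Lemma Im_le_cabs z : `|complex.Im z| <= cabs z.
Proof.
case: z => x y; rewrite [cabs _]/(Normc.normc _) /= -sqrtr_sqr ler_sqrt ?lerDr ?sqr_ge0//.
by rewrite addr_ge0 ?sqr_ge0.
Qed.

Lemma cabs_le_ReIm z : cabs z <= `|complex.Re z| + `|complex.Im z|.
Proof.
rewrite (complexE z) (le_trans (cabsD _ _))// cabsM cabs_i mul1r !cabs_real.
by case: z => x y; simpc.
Qed.

Lemma ReD z w : complex.Re (z + w) = complex.Re z + complex.Re w.
Proof. by case: z w => ? ? [? ?]. Qed.
Lemma ImD z w : complex.Im (z + w) = complex.Im z + complex.Im w.
Proof. by case: z w => ? ? [? ?]. Qed.
Lemma ReB z w : complex.Re (z - w) = complex.Re z - complex.Re w.
Proof. by case: z w => ? ? [? ?]. Qed.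
Lemma ImB z w : complex.Im (z - w) = complex.Im z - complex.Im w.
Proof. by case: z w => ? ? [? ?]. Qed.
Lemma ReM z w : complex.Re (z * w) =
  complex.Re z * complex.Re w - complex.Im z * complex.Im w.
Proof. by case: z w => ? ? [? ?]. Qed.
Lemma ImM z w : complex.Im (z * w) =
  complex.Re z * complex.Im w + complex.Im z * complex.Re w.
Proof. by case: z w => ? ? [? ?]. Qed.

Lemma complex_eq z w : complex.Re z = complex.Re w ->
  complex.Im z = complex.Im w -> z = w.
Proof. by case: z w => ? ? [? ?] /= -> ->. Qed.

Lemma complex_gt0E (e : C) : 0 < e -> exists2 r : R, 0 < r & e = r%:C.
Proof.
case: e => x y; rewrite ltcE /= => /andP[/eqP -> x0]; by exists x.
Qed.

Lemma near_complexP z (P : C -> Prop) :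
  (\forall w \near z, P w) <->
  exists2 r : R, 0 < r & forall w, cabs (w - z) < r -> P w.
Proof.
split.
  move/nbhs_ballP => [e /= /complex_gt0E[r r0 ->] h]; exists r => // w hw.
  by apply: h; rewrite -ball_normE /ball_ /= cabsE ltcR cabs_distC.
move=> [r r0 h]; apply/nbhs_ballP; exists r%:C => /=; first by rewrite ltcR.
by move=> w; rewrite -ball_normE /ball_ /= cabsE ltcR cabs_distC => /h.
Qed.

Lemma cvg_complexP {T : Type} (F : set_system T) {FF : Filter F}
    (f : T -> C) z :
  f @ F --> z <-> forall e : R, 0 < e -> \forall x \near F, cabs (f x - z) < e.
Proof.
split.
  move=> /cvgrPdist_lt h e e0; have := h e%:C; rewrite ltcR => /(_ e0).
  by apply: filterS => x; rewrite cabsE ltcR cabs_distC.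
move=> h; apply/cvgrPdist_lt => e /complex_gt0E[r r0 ->].
by apply: filterS (h r r0) => x; rewrite cabsE ltcR cabs_distC.
Qed.

Lemma cvg_Re {T : Type} (F : set_system T) {FF : Filter F} (f : T -> C) z :
  f @ F --> z -> complex.Re (f x) @[x --> F] --> complex.Re z.
Proof.
move=> /cvg_complexP h; apply/cvgrPdist_lt => e e0.
apply: filterS (h e e0) => x; apply: le_lt_trans.
by rewrite -ReB cabs_distC Re_le_cabs.
Qed.

Lemma cvg_Im {T : Type} (F : set_system T) {FF : Filter F} (f : T -> C) z :
  f @ F --> z -> complex.Im (f x) @[x --> F] --> complex.Im z.
Proof.
move=> /cvg_complexP h; apply/cvgrPdist_lt => e e0.
apply: filterS (h e e0) => x; apply: le_lt_trans.
by rewrite -ImB cabs_distC Im_le_cabs.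
Qed.

End ComplexBasics.
Arguments cabs : simpl never.

(** * Integrals of complex functions over real segments *)

Section SegmentIntegral.
Context {R : realType}.
Local Notation C := R[i].
Local Notation mu := (@lebesgue_measure R).
Implicit Types (a b c : R) (u v : R -> C).

Definition seg_integral a b u : C :=
  (\int[mu]_(t in `[a, b]) complex.Re (u t))
  +i* (\int[mu]_(t in `[a, b]) complex.Im (u t)).

Definition seg_integrable a b u : Prop :=
  mu.-integrable `[a, b] (EFin \o (fun t => complex.Re (u t))) /\
  mu.-integrable `[a, b] (EFin \o (fun t => complex.Im (u t))).

Lemma seg_integrable_continuous a b u :
  (forall t, a <= t <= b -> u x @[x --> t] --> u t) -> seg_integrable a b u.
Proof.
move=> h; split; apply: continuous_compact_integrable;
  try exact: segment_compact; apply: continuous_in_subspaceT => t tab.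
- by apply: cvg_Re; apply: h; move: tab; rewrite inE /= in_itv.
- by apply: cvg_Im; apply: h; move: tab; rewrite inE /= in_itv.
Qed.

Lemma eq_seg_integral a b u v :
  (forall t, a <= t <= b -> u t = v t) -> seg_integral a b u = seg_integral a b v.
Proof.
move=> h; congr (_ +i* _); apply: eq_Rintegral => t; rewrite inE /= in_itv => tab;
by rewrite h.
Qed.

Lemma eq_seg_integrable a b u v :
  (forall t, a <= t <= b -> u t = v t) -> seg_integrable a b u -> seg_integrable a b v.
Proof.
move=> h [h1 h2]; split.
- apply: eq_integrable h1 => //= t; rewrite inE /= in_itv => tab; by rewrite h.
- apply: eq_integrable h2 => //= t; rewrite inE /= in_itv => tab; by rewrite h.
Qed.

Let mI a b : measurable (`[a, b] : set (measurableTypeR R)).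
Proof. exact: measurable_itv. Qed.

Lemma seg_integrableD a b u v : seg_integrable a b u -> seg_integrable a b v ->
  seg_integrable a b (fun t => u t + v t).
Proof.
move=> [u1 u2] [v1 v2]; split.
- have := integrableD (mI a b) u1 v1.
  by apply: eq_integrable => //= t _; rewrite ReD.
- have := integrableD (mI a b) u2 v2.
  by apply: eq_integrable => //= t _; rewrite ImD.
Qed.

Lemma seg_integrableZ a b (k : C) u : seg_integrable a b u ->
  seg_integrable a b (fun t => k * u t).
Proof.
move=> [u1 u2]; split.
- have := integrableB (mI a b)
     (integrableZl (mI a b) (complex.Re k) u1)
     (integrableZl (mI a b) (complex.Im k) u2).
  by apply: eq_integrable => //= t _; rewrite ReM.
- have := integrableD (mI a b)
     (integrableZl (mI a b) (complex.Re k) u2)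
     (integrableZl (mI a b) (complex.Im k) u1).
  by apply: eq_integrable => //= t _; rewrite ImM.
Qed.

Lemma seg_integrableB a b u v : seg_integrable a b u -> seg_integrable a b v ->
  seg_integrable a b (fun t => u t - v t).
Proof.
move=> su sv; have := seg_integrableD su (seg_integrableZ (-1) sv).
by apply: eq_seg_integrable => t _; rewrite mulN1r.
Qed.

Lemma seg_integrable_cst a b (k : C) : seg_integrable a b (fun=> k).
Proof. by apply: seg_integrable_continuous => t _; exact: cvg_cst. Qed.

Lemma seg_integralD a b u v : seg_integrable a b u -> seg_integrable a b v ->
  seg_integral a b (fun t => u t + v t) = seg_integral a b u + seg_integral a b v.
Proof.
move=> [u1 u2] [v1 v2]; rewrite /seg_integral; apply: complex_eq => /=.
- rewrite -RintegralD//; apply: eq_Rintegral => t _; exact: ReD.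
- rewrite -RintegralD//; apply: eq_Rintegral => t _; exact: ImD.
Qed.

Let RintegralZ a b (r : R) (f : R -> R) :
  mu.-integrable `[a, b] (EFin \o f) ->
  mu.-integrable `[a, b] (EFin \o (fun t => r * f t)).
Proof. by move=> /(integrableZl (mI a b) r). Qed.

Lemma seg_integralZ a b (k : C) u : seg_integrable a b u ->
  seg_integral a b (fun t => k * u t) = k * seg_integral a b u.
Proof.
move=> [u1 u2]; rewrite /seg_integral; apply: complex_eq => /=.
- rewrite ReM /= -!RintegralZl// -RintegralB//; try exact: RintegralZ.
  by apply: eq_Rintegral => t _; exact: ReM.
- rewrite ImM /= -!RintegralZl// -RintegralD//; try exact: RintegralZ.
  by apply: eq_Rintegral => t _; exact: ImM.
Qed.

Lemma seg_integralB a b u v : seg_integrable a b u -> seg_integrable a b v ->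
  seg_integral a b (fun t => u t - v t) = seg_integral a b u - seg_integral a b v.
Proof.
move=> su sv; rewrite -(mulN1r (seg_integral a b v)) -seg_integralZ// -seg_integralD//.
  by apply: eq_seg_integral => t _; rewrite mulN1r.
exact: seg_integrableZ.
Qed.

Let mu_itv a b : a <= b -> fine (mu `[a, b]) = b - a.
Proof.
by move=> ab; rewrite lebesgue_measure_itv /= lte_fin; case: ltgtP ab => //= -> _;
  rewrite subrr.
Qed.

Lemma seg_integral_cst a b (k : C) : a <= b -> seg_integral a b (fun=> k) = k * (b - a)%:C.
Proof.
move=> ab; rewrite /seg_integral !Rintegral_cst// mu_itv//.
by case: k => x y; simpc.
Qed.

Lemma seg_integral_cat c a b u : a <= c -> c <= b -> seg_integrable a b u ->
  seg_integral a b u = seg_integral a c u + seg_integral c b u.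
Proof.
move=> ac cb su.
have key (f : R -> R) : mu.-integrable `[a, b] (EFin \o f) ->
    \int[mu]_(t in `[a, b]) f t =
    \int[mu]_(t in `[a, c]) f t + \int[mu]_(t in `[c, b]) f t.
  move=> mf; have := @Rintegral_itvB _ f (BLeft a) (BRight b) c mf.
  rewrite !bnd_simp => /(_ ac cb) h.
  rewrite -(@Rintegral_itv_obnd_cbnd _ c)//; last first.
    by apply: integrableS mf => //; apply: subset_itv; rewrite bnd_simp.
  by rewrite -h addrCA subrr addr0.
by case: su => u1 u2; rewrite /seg_integral (key _ u1) (key _ u2).
Qed.

(** The factor 2 comes from bounding the real and imaginary parts separately. *)
Lemma seg_integral_bound a b u (M : R) : a <= b -> seg_integrable a b u ->
  (forall t, a <= t <= b -> cabs (u t) <= M) ->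
  cabs (seg_integral a b u) <= 2 * M * (b - a).
Proof.
move=> ab [u1 u2] h.
have key (f : R -> R) : mu.-integrable `[a, b] (EFin \o f) ->
   (forall t, a <= t <= b -> `|f t| <= M) ->
   `|\int[mu]_(t in `[a, b]) f t| <= M * (b - a).
  move=> mf fM; apply: (le_trans (le_normr_Rintegral _ mf)) => //.
  rewrite -(mu_itv ab) -Rintegral_cst//; apply: le_Rintegral => //.
  - exact: (integrable_norm mf).
  - by apply: continuous_compact_integrable;
      [exact: segment_compact | apply: continuous_subspaceT => ?; exact: cvg_cst].
apply: (le_trans (cabs_le_ReIm _)).
have -> : 2 * M * (b - a) = M * (b - a) + M * (b - a) by ring.
apply: lerD; apply: key => // t tab; apply: le_trans (h t tab).
- exact: Re_le_cabs.
- exact: Im_le_cabs.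
Qed.

End SegmentIntegral.
Arguments seg_integral : simpl never.

(** * Contour integrals over rectangles *)

Section Rectangles.
Context {R : realType}.
Local Notation C := R[i].
Implicit Types (a b c d e x y : R) (f g : C -> C).

(** The counterclockwise integral of f(z) dz along the boundary of the rectangle
    [a, b] x [c, d], opposite sides being combined. *)
Definition rect_contour f a b c d : C :=
  seg_integral a b (fun x => f (x +i* c) - f (x +i* d))
  + 'i * seg_integral c d (fun y => f (b +i* y) - f (a +i* y)).

Lemma cvg_horizontal c x : (t +i* c : C) @[t --> x] --> (x +i* c : C).
Proof.
apply/cvg_complexP => e e0; near=> t.
have -> : (t +i* c) - (x +i* c) = (t - x)%:C :> C.
  by apply: complex_eq; rewrite /= ?subrr.
rewrite cabs_real distrC; near: t; exact: (@cvgr_dist_lt _ _ _ _ _ id x).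
Unshelve. all: by end_near. Qed.

Lemma cvg_vertical a y : (a +i* t : C) @[t --> y] --> (a +i* y : C).
Proof.
apply/cvg_complexP => e e0; near=> t.
have -> : (a +i* t) - (a +i* y) = 'i * (t - y)%:C :> C.
  by apply: complex_eq; rewrite /=; ring.
rewrite cabsM cabs_i mul1r cabs_real distrC; near: t.
exact: (@cvgr_dist_lt _ _ _ _ _ id y).
Unshelve. all: by end_near. Qed.

Lemma seg_integrable_horizontal f a b c :
  (forall x, a <= x <= b -> {for x +i* c, continuous f}) ->
  seg_integrable a b (fun x => f (x +i* c)).
Proof.
move=> h; apply: seg_integrable_continuous => t /h ft.
exact: (cvg_comp _ _ (@cvg_horizontal c t) ft).
Qed.

Lemma seg_integrable_vertical f a c d :
  (forall y, c <= y <= d -> {for a +i* y, continuous f}) ->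
  seg_integrable c d (fun y => f (a +i* y)).
Proof.
move=> h; apply: seg_integrable_continuous => t /h ft.
exact: (cvg_comp _ _ (@cvg_vertical a t) ft).
Qed.

Definition continuous_on_sides f a b c d : Prop :=
  (forall x, a <= x <= b ->
     {for x +i* c, continuous f} /\ {for x +i* d, continuous f}) /\
  (forall y, c <= y <= d ->
     {for a +i* y, continuous f} /\ {for b +i* y, continuous f}).

Lemma seg_integrable_sides f a b c d : continuous_on_sides f a b c d ->
  [/\ seg_integrable a b (fun x => f (x +i* c)), seg_integrable a b (fun x => f (x +i* d)),
      seg_integrable c d (fun y => f (a +i* y)) &
      seg_integrable c d (fun y => f (b +i* y))].
Proof.
by move=> [h v]; split; [apply: seg_integrable_horizontal|apply: seg_integrable_horizontal
  |apply: seg_integrable_vertical|apply: seg_integrable_vertical] => t =>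
  [/h[]|/h[]|/v[]|/v[]].
Qed.

Lemma rect_contourB f g a b c d :
  continuous_on_sides f a b c d -> continuous_on_sides g a b c d ->
  rect_contour (fun z => f z - g z) a b c d =
  rect_contour f a b c d - rect_contour g a b c d.
Proof.
move=> /seg_integrable_sides[f1 f2 f3 f4] /seg_integrable_sides[g1 g2 g3 g4].
rewrite /rect_contour !seg_integralB//; try exact: seg_integrableB.
by ring.
Qed.

Lemma rect_contourZ f (k : C) a b c d : continuous_on_sides f a b c d ->
  rect_contour (fun z => k * f z) a b c d = k * rect_contour f a b c d.
Proof.
move=> /seg_integrable_sides[f1 f2 f3 f4].
rewrite /rect_contour !seg_integralB//; try exact: seg_integrableZ.
by rewrite !seg_integralZ//; ring.
Qed.

(** This replaces the existence of a primitive in the proof of Goursat's theorem: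
    an affine function has constant differences between opposite sides. *)
Lemma rect_contour_affine (k l : C) a b c d : a <= b -> c <= d ->
  rect_contour (fun z => k + l * z) a b c d = 0.
Proof.
move=> ab cd; rewrite /rect_contour.
rewrite (@eq_seg_integral _ a b _ (fun=> l * ('i * (c - d)%:C))); last first.
  by move=> t _; apply: complex_eq; rewrite /= !(ReB,ImB,ReD,ImD,ReM,ImM) /=; ring.
rewrite (@eq_seg_integral _ c d _ (fun=> l * (b - a)%:C)); last first.
  by move=> t _; apply: complex_eq; rewrite /= !(ReB,ImB,ReD,ImD,ReM,ImM) /=; ring.
by rewrite !seg_integral_cst// !rmorphB /=; ring.
Qed.

Lemma rect_contour_cutx f a e b c d : a <= e -> e <= b ->
  continuous_on_sides f a b c d -> (forall y, c <= y <= d ->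
    {for e +i* y, continuous f}) ->
  rect_contour f a b c d = rect_contour f a e c d + rect_contour f e b c d.
Proof.
move=> ae eb /seg_integrable_sides[f1 f2 f3 f4] /seg_integrable_vertical f5.
rewrite /rect_contour.
rewrite (@seg_integral_cat _ e a b)//; last exact: seg_integrableB.
by rewrite !(@seg_integralB _ c d)//; ring.
Qed.

Lemma rect_contour_cuty f a b c e d : c <= e -> e <= d ->
  continuous_on_sides f a b c d -> (forall x, a <= x <= b ->
    {for x +i* e, continuous f}) ->
  rect_contour f a b c d = rect_contour f a b c e + rect_contour f a b e d.
Proof.
move=> ce ed /seg_integrable_sides[f1 f2 f3 f4] /seg_integrable_horizontal f5.
rewrite /rect_contour.
rewrite (@seg_integral_cat _ e c d)//; last exact: seg_integrableB.
by rewrite !(@seg_integralB _ a b)//; ring.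
Qed.

Lemma rect_contour_bound f a b c d (M : R) : a <= b -> c <= d ->
  continuous_on_sides f a b c d ->
  (forall x, a <= x <= b -> cabs (f (x +i* c)) <= M /\ cabs (f (x +i* d)) <= M) ->
  (forall y, c <= y <= d -> cabs (f (a +i* y)) <= M /\ cabs (f (b +i* y)) <= M) ->
  cabs (rect_contour f a b c d) <= 4 * M * ((b - a) + (d - c)).
Proof.
move=> ab cd /seg_integrable_sides[f1 f2 f3 f4] h v.
have h1 := seg_integral_bound ab (seg_integrableB f1 f2).
have h2 := seg_integral_bound cd (seg_integrableB f4 f3).
apply: (le_trans (cabsD _ _)); rewrite cabsM cabs_i mul1r.
have -> : 4 * M * (b - a + (d - c)) =
  2 * (M + M) * (b - a) + 2 * (M + M) * (d - c) by ring.
apply: lerD; [apply: h1|apply: h2] => t th; apply: (le_trans (cabsB _ _)).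
- by have [? ?] := h t th; apply: lerD.
- by have [? ?] := v t th; apply: lerD.
Qed.

Definition on_rect (P : C -> Prop) a b c d :=
  forall x y, a <= x <= b -> c <= y <= d -> P (x +i* y).

Lemma on_rect_sides f a b c d : a <= b -> c <= d ->
  on_rect (fun z => {for z, continuous f}) a b c d -> continuous_on_sides f a b c d.
Proof.
by move=> ab cd h; split=> t th; split; apply: h => //; rewrite lexx ?ab ?cd.
Qed.

Lemma derivable_continuous f z : derivable f z 1 -> {for z, continuous f}.
Proof.
move=> df; have [h _] := derivable1_diffP f z.
exact: (differentiable_continuous (h df)).
Qed.

Lemma derivable_approx f z : derivable f z 1 -> forall e : R, 0 < e ->
  \forall w \near z, cabs (f w - f z - 'D_1 f z * (w - z)) <= e * cabs (w - z).
Proof.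
move=> df e e0; have /cvg_complexP /(_ e e0) : 
  (fun h : C => h^-1 *: ((f \o shift z) (h *: 1) - f z)) @ 0^' --> 'D_1 f z.
  exact: df.
rewrite near_withinE => /near_complexP[r r0 h]; apply/near_complexP.
exists r => // w wr.
have [->|wz] := eqVneq w z; first by rewrite !subrr mulr0 subrr cabs0 mulr0.
have wz0 : w - z != 0 by rewrite subr_eq0.
have := h (w - z); rewrite subr0 => /(_ wr wz0) /ltW.
rewrite /= /GRing.scale /= mulr1 subrK => h1.
have -> : f w - f z - 'D_1 f z * (w - z) =
  ((w - z)^-1 * (f w - f z) - 'D_1 f z) * (w - z) by field.
by rewrite cabsM ler_wpM2r// cabs_ge0.
Qed.

End Rectangles.
Arguments rect_contour : simpl never.

(** * Goursat's theorem *)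

Section Goursat.
Context {R : realType}.
Local Notation C := R[i].
Implicit Types (a b c d h k : R) (f : C -> C).

Lemma on_rect_sub (P : C -> Prop) a b c d a' b' c' d' :
  a <= a' -> b' <= b -> c <= c' -> d' <= d ->
  on_rect P a b c d -> on_rect P a' b' c' d'.
Proof.
move=> aa bb cc dd H x y /andP[ax xb] /andP[cy yd]; apply: H.
- by rewrite (le_trans aa ax) (le_trans xb bb).
- by rewrite (le_trans cc cy) (le_trans yd dd).
Qed.

(** The contour integral is the sum of those over the four quadrants, so one of
    them carries at least a quarter of it. *)
Lemma worst_quadrant f a c h k : 0 <= h -> 0 <= k ->
  on_rect (fun z => {for z, continuous f}) a (a + 2 * h) c (c + 2 * k) ->
  exists p : R * R,
    [/\ a <= p.1 <= a + h, c <= p.2 <= c + k &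
        cabs (rect_contour f a (a + 2 * h) c (c + 2 * k)) <=
        4 * cabs (rect_contour f p.1 (p.1 + h) p.2 (p.2 + k))].
Proof.
move=> h0 k0 cf.
have cut : rect_contour f a (a + 2 * h) c (c + 2 * k) =
   rect_contour f a (a + h) c (c + k)
   + rect_contour f a (a + h) (c + k) (c + k + k)
   + (rect_contour f (a + h) (a + h + h) c (c + k)
   + rect_contour f (a + h) (a + h + h) (c + k) (c + k + k)).
  rewrite (@rect_contour_cutx _ f a (a + h)); first last.
  - by move=> y hy; apply: cf => //; lra.
  - by apply: on_rect_sides cf; lra.
  - by lra.
  - by lra.
  have -> : a + 2 * h = a + h + h by ring.
  have -> : c + 2 * k = c + k + k by ring.
  by congr (_ + _); (apply: rect_contour_cuty; [lra|lra
    |apply: on_rect_sides; [lra|lra|apply: on_rect_sub cf; lra]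
    |move=> x hx; apply: cf; lra]).
apply: contrapT => /forallNP no.
pose v := cabs (rect_contour f a (a + 2 * h) c (c + 2 * k)).
have lt p : a <= p.1 <= a + h -> c <= p.2 <= c + k ->
    cabs (rect_contour f p.1 (p.1 + h) p.2 (p.2 + k)) < v / 4.
  move=> h1 h2; rewrite ltNge; apply/negP => h3; apply: (no p); split => //.
  by move: h3; rewrite ler_pdivrMr// [X in _ <= X]mulrC.
have [ha hah] : a <= a <= a + h /\ a <= a + h <= a + h.
  by rewrite !lexx lerDl h0.
have [hc hck] : c <= c <= c + k /\ c <= c + k <= c + k.
  by rewrite !lexx lerDl k0.
have l1 := lt (a, c) ha hc; have l2 := lt (a, c + k) ha hck.
have l3 := lt (a + h, c) hah hc; have l4 := lt (a + h, c + k) hah hck.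
move: l1 l2 l3 l4 => /= l1 l2 l3 l4.
suff : v < v by rewrite ltxx.
rewrite {1}/v cut; apply: (le_lt_trans (cabsD _ _)).
apply: (le_lt_trans (lerD (cabsD _ _) (cabsD _ _))). lra.
Qed.

(** Iterating [worst_quadrant] yields nested rectangles, of sides divided by 2^n,
    whose integrals are at least eta / 4^n. At their common point f is affine up
    to o(distance), and the affine part integrates to 0, so the integrals are
    o(4^-n). *)
Theorem goursat f a b c d : a <= b -> c <= d ->
  on_rect (fun z => derivable f z 1) a b c d -> rect_contour f a b c d = 0.
Proof.
move=> ab cd df; apply/eqP; rewrite -cabs_eq0; apply: contraT => N0.
set eta := cabs _ in N0.
have eta0 : 0 < eta by rewrite lt_def N0 cabs_ge0.
set l := b - a; set m := d - c.
have l0 : 0 <= l by rewrite /l; lra.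
have m0 : 0 <= m by rewrite /m; lra.
pose H n := l / 2 ^+ n; pose K n := m / 2 ^+ n.
have pow0 n : 0 < 2 ^+ n :> R by rewrite exprn_gt0.
have H0 n : 0 <= H n by rewrite divr_ge0// ltW.
have K0 n : 0 <= K n by rewrite divr_ge0// ltW.
have HS n : H n = 2 * H n.+1.
  by rewrite /H exprS; field; rewrite gt_eqF.
have KS n : K n = 2 * K n.+1.
  by rewrite /K exprS; field; rewrite gt_eqF.
pose good n (p : R * R) :=
  [/\ a <= p.1, p.1 + H n <= b, c <= p.2, p.2 + K n <= d &
      eta / 4 ^+ n <=
        cabs (rect_contour f p.1 (p.1 + H n) p.2 (p.2 + K n))].
have cf : on_rect (fun z => {for z, continuous f}) a b c d.
  by move=> x y hx hy; apply: derivable_continuous; exact: df.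
have step (np : nat * (R * R)) : exists q : R * R, good np.1 np.2 ->
    [/\ good np.1.+1 q, np.2.1 <= q.1 <= np.2.1 + H np.1.+1 &
        np.2.2 <= q.2 <= np.2.2 + K np.1.+1].
  case: np => n p /=; case: (pselect (good n p)) => [|ng]; last by exists p.
  move=> [h1 h2 h3 h4 h5]; have := @worst_quadrant f p.1 p.2 _ _ (H0 n.+1) (K0 n.+1).
  rewrite -HS -KS => /(_ (on_rect_sub h1 h2 h3 h4 cf)) [q [q1 q2 q3]].
  exists q => _; split => //; move: (HS n) (KS n) => hs ks; split; try lra.
  rewrite -(ler_pM2l (_ : 0 < 4 :> R))//; apply: le_trans q3.
  apply: le_trans h5; rewrite (_ : 4 * _ = eta / 4 ^+ n)// exprS.
  by field; rewrite ?expf_neq0.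
have [F FP] := choice step.
pose u := fix u n := if n is n'.+1 then F (n', u n') else (a, c).
have gu n : good n (u n).
  elim: n => [|n IH]; last by have [] := FP (n, u n) IH.
  by split; rewrite /= /H /K ?expr0 ?divr1 ?lexx// /l /m ?subrKC.
have u1 n : (u n).1 <= (u n.+1).1 <= (u n).1 + H n.+1.
  by have [] := FP (n, u n) (gu n).
have u2 n : (u n).2 <= (u n.+1).2 <= (u n).2 + K n.+1.
  by have [] := FP (n, u n) (gu n).
have nested (v : R^nat) (L : R^nat) : (forall n, L n = 2 * L n.+1) ->
    (forall n, 0 <= L n) ->
    (forall n, v n <= v n.+1 <= v n + L n.+1) ->
    exists x, forall n, v n <= x <= v n + L n.
  move=> LS L0 hv.
  have up n j : v n <= v (n + j)%N.
    elim: j => [|j IH]; rewrite ?addn0// addnS (le_trans IH)//.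
    by have /andP[] := hv (n + j)%N.
  have dn n j : v (n + j)%N + L (n + j)%N <= v n + L n.
    elim: j => [|j IH]; rewrite ?addn0// addnS (le_trans _ IH)//.
    by have /andP[_] := hv (n + j)%N; have := LS (n + j)%N; lra.
  have ubd n i : v i <= v n + L n.
    have [ni|/ltnW ni] := leqP n i.
      by have := dn n (i - n)%N; rewrite subnKC//; have := L0 i; lra.
    by have := up i (n - i)%N; rewrite subnKC//; have := L0 n; lra.
  exists (sup (range v)) => n; apply/andP; split.
    apply: ub_le_sup; last by exists n.
    by exists (v 0%N + L 0%N) => _ [i _ <-].
  by apply: ge_sup; [exists (v 0%N); exists 0%N|move=> _ [i _ <-]].
have [x hx] := nested (fun n => (u n).1) H HS H0 u1.
have [y hy] := nested (fun n => (u n).2) K KS K0 u2.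
have xab : a <= x <= b.
  by have := hx 0%N; have [] := gu 0%N; lra.
have ycd : c <= y <= d.
  by have := hy 0%N; have [] := gu 0%N; lra.
set z := x +i* y.
set S := l + m + 1.
have S0 : 0 < S by rewrite /S; lra.
(* The integral over the n-th rectangle is at most 4 e S^2 / 4^n, which this
   choice makes half of the lower bound. *)
pose e := eta / (8 * S ^+ 2).
have e0 : 0 < e by rewrite divr_gt0// mulr_gt0// exprn_gt0.
have /near_complexP[r r0 hr] := derivable_approx (df _ _ xab ycd) e0.
have [n nr] : exists n, (l + m) / 2 ^+ n < r.
  have [n hn] : exists n : nat, (l + m) / r < n%:R.
    have lmr : 0 <= (l + m) / r by apply: divr_ge0; [exact: addr_ge0|exact: ltW].
    by exists (Num.bound ((l + m) / r)); exact: archi_boundP.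
  exists n; rewrite ltr_pdivrMr// mulrC -ltr_pdivrMr//.
  by apply: (lt_le_trans hn); rewrite -natrX ler_nat ltnW// ltn_expl.
have [g1 g2 g3 g4 g5] := gu n.
set p := u n in g1 g2 g3 g4 g5.
set D := 'D_1 f z.
pose A w := (f z - D * z) + D * w.
have close s t : p.1 <= s <= p.1 + H n -> p.2 <= t <= p.2 + K n ->
    cabs ((s +i* t) - z) <= (l + m) / 2 ^+ n.
  move=> hs ht; apply: (le_trans (cabs_le_ReIm _)); rewrite /z /=.
  have -> : (l + m) / 2 ^+ n = H n + K n by rewrite /H /K mulrDl.
  by have := hx n; have := hy n; rewrite -/p => hy' hx';
    apply: lerD; rewrite ler_norml; lra.
have rem s t : p.1 <= s <= p.1 + H n -> p.2 <= t <= p.2 + K n ->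
    cabs (f (s +i* t) - A (s +i* t)) <= e * ((l + m) / 2 ^+ n).
  move=> hs ht; have cl := close s t hs ht.
  have := hr (s +i* t) (le_lt_trans cl nr).
  have -> : f (s +i* t) - f z - 'D_1 f z * ((s +i* t) - z) =
            f (s +i* t) - A (s +i* t) by rewrite /A -/D; ring.
  by move=> /le_trans; apply; rewrite ler_pM2l.
have pH : p.1 <= p.1 + H n by have := H0 n; lra.
have pK : p.2 <= p.2 + K n by have := K0 n; lra.
have Acont w : {for w, continuous A}.
  apply: (@continuousD _ _ _ (cst (f z - D * z)) (fun w => D * w)).
    exact: cst_continuous.
  by apply: (@continuousM _ _ (cst D) id); [exact: cst_continuous|move=> ?; exact: cvg_id].
have cfp := on_rect_sub g1 g2 g3 g4 cf.
have sf : continuous_on_sides f p.1 (p.1 + H n) p.2 (p.2 + K n).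
  exact: (on_rect_sides pH pK cfp).
have sA : continuous_on_sides A p.1 (p.1 + H n) p.2 (p.2 + K n).
  exact: (on_rect_sides pH pK (fun x y _ _ => Acont (x +i* y))).
have sfA : continuous_on_sides (fun w => f w - A w) p.1 (p.1 + H n) p.2 (p.2 + K n).
  apply: (on_rect_sides pH pK) => s t hs ht.
  exact: (continuousB (cfp s t hs ht) (Acont (s +i* t))).
have contE : rect_contour f p.1 (p.1 + H n) p.2 (p.2 + K n) =
    rect_contour (fun w => f w - A w) p.1 (p.1 + H n) p.2 (p.2 + K n).
  by rewrite rect_contourB// [X in _ - X]rect_contour_affine// subr0.
have := rect_contour_bound (M := e * ((l + m) / 2 ^+ n)) pH pK sfA.
rewrite -contE => /(_ _ _)/(le_trans g5) => bd.
have {bd} : eta / 4 ^+ n <=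
    4 * (e * ((l + m) / 2 ^+ n)) * (p.1 + H n - p.1 + (p.2 + K n - p.2)).
  by apply: bd => t ht; split; apply: rem; rewrite ?lexx ?pH ?pK.
have -> : 4 * (e * ((l + m) / 2 ^+ n)) * (p.1 + H n - p.1 + (p.2 + K n - p.2))
   = 4 * e * (l + m) ^+ 2 / 4 ^+ n.
  rewrite /H /K (_ : 4 ^+ n = 2 ^+ n * 2 ^+ n); last first.
    by rewrite -exprMn; congr (_ ^+ _); ring.
  by field; rewrite gt_eqF.
rewrite ler_pM2r ?invr_gt0 ?exprn_gt0// => bd.
have : 4 * e * (l + m) ^+ 2 <= 4 * e * S ^+ 2.
  apply: ler_wpM2l; first by rewrite mulr_ge0// ltW.
  have lm0 : 0 <= l + m by apply: addr_ge0.
  by apply: lerXn2r; rewrite ?nnegrE ?lerDl// ltW.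
have -> : 4 * e * S ^+ 2 = eta / 2 by rewrite /e; field; rewrite gt_eqF.
move: bd eta0; lra.
Qed.

End Goursat.

(** * Cauchy's formula for the derivative *)

Section CauchyKernel.
Context {R : realType}.
Local Notation C := R[i].
Implicit Types (f g : C -> C) (e : R).

Definition unit_square (P : C -> Prop) := on_rect P (-1) 1 (-1) 1.

(** The number 2 pi i, by which Cauchy's formula divides. *)
Definition winding : C := rect_contour (fun z : C => z^-1) (-1) 1 (-1) 1.

Lemma square_side_cabs_ge x y e : 0 <= e ->
  x = e \/ x = - e \/ y = e \/ y = - e -> e <= cabs (x +i* y : C).
Proof.
move=> e0 [|[|[|]]] h.
- by apply: le_trans (Re_le_cabs _); rewrite /= h ger0_norm.
- by apply: le_trans (Re_le_cabs _); rewrite /= h normrN ger0_norm.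
- by apply: le_trans (Im_le_cabs _); rewrite /= h ger0_norm.
- by apply: le_trans (Im_le_cabs _); rewrite /= h normrN ger0_norm.
Qed.

Lemma square_cabs_le x y e : -e <= x <= e -> -e <= y <= e ->
  cabs (x +i* y : C) <= 2 * e.
Proof.
move=> hx hy; apply: (le_trans (cabs_le_ReIm _)) => /=.
have -> : 2 * e = e + e by ring.
by apply: lerD; rewrite ler_norml.
Qed.

Lemma square_side_neq0 x y e : 0 < e ->
  x = e \/ x = - e \/ y = e \/ y = - e -> (x +i* y : C) != 0.
Proof.
by move=> e0 /(square_side_cabs_ge (ltW e0)) h; rewrite -cabs_gt0 (lt_le_trans e0).
Qed.

Lemma continuous_on_square_sides f e : 0 < e ->
  on_rect (fun z => z != 0 -> {for z, continuous f}) (-e) e (-e) e ->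
  continuous_on_sides f (-e) e (-e) e.
Proof.
move=> e0 cf; split=> t th; split; (apply: cf; [lra|lra|]);
  apply: (square_side_neq0 e0); tauto.
Qed.

(** The region between two concentric squares is cut into the strips above and
    below the smaller square and the two rectangles beside it, and Goursat's
    theorem applies to each of the four. *)
Lemma rect_contour_shrink f e : 0 < e -> e <= 1 ->
  unit_square (fun z => z != 0 -> derivable f z 1) ->
  rect_contour f (-1) 1 (-1) 1 = rect_contour f (-e) e (-e) e.
Proof.
move=> e0 e1 df.
have cf : unit_square (fun z => z != 0 -> {for z, continuous f}).
  by move=> x y hx hy z0; apply: derivable_continuous; exact: df.
have ne (x y : R) : x != 0 \/ y != 0 -> (x +i* y : C) != 0.
  by rewrite eq_complex /= negb_and => -[] ->; rewrite ?orbT.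
have good (a b c d : R) : a <= b -> c <= d -> -1 <= a -> b <= 1 -> -1 <= c -> d <= 1 ->
    (0 < a \/ b < 0 \/ 0 < c \/ d < 0) -> rect_contour f a b c d = 0.
  move=> ab cd a1 b1 c1 d1 off; apply: goursat => // x y hx hy.
  apply: df; [lra|lra|]; apply: ne.
  by case: off => [|[|[|]]] o; [left|left|right|right]; apply/eqP; lra.
have good1 : rect_contour f (-1) 1 (-1) (-e) = 0.
  by apply: good; [lra|lra|lra|lra|lra|lra|right; right; right; lra].
have good2 : rect_contour f (-1) 1 e 1 = 0.
  by apply: good; [lra|lra|lra|lra|lra|lra|right; right; left; lra].
have good3 : rect_contour f (-1) (-e) (-e) e = 0.
  by apply: good; [lra|lra|lra|lra|lra|lra|right; left; lra].
have good4 : rect_contour f e 1 (-e) e = 0.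
  by apply: good; [lra|lra|lra|lra|lra|lra|left; lra].
rewrite (@rect_contour_cuty _ f _ _ _ (-e)); first last.
- by move=> x hx; apply: cf; [lra|lra|]; apply: ne; right; apply/eqP; lra.
- by apply: continuous_on_square_sides.
- by lra.
- by lra.
rewrite good1 add0r.
rewrite (@rect_contour_cuty _ f _ _ _ e); first last.
- by move=> x hx; apply: cf; [lra|lra|]; apply: ne; right; apply/eqP; lra.
- split=> t th; split; (apply: cf; [lra|lra|]); apply: ne;
  first [left; apply/eqP; lra | right; apply/eqP; lra].
- by lra.
- by lra.
rewrite good2 addr0.
rewrite (@rect_contour_cutx _ f _ (-e)); first last.
- by move=> x hx; apply: cf; [lra|lra|]; apply: ne; left; apply/eqP; lra.
- split=> t th; split; (apply: cf; [lra|lra|]); apply: ne;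
  first [left; apply/eqP; lra | right; apply/eqP; lra].
- by lra.
- by lra.
rewrite good3 add0r.
rewrite (@rect_contour_cutx _ f _ e); first last.
- by move=> x hx; apply: cf; [lra|lra|]; apply: ne; left; apply/eqP; lra.
- split=> t th; split; (apply: cf; [lra|lra|]); apply: ne;
  first [left; apply/eqP; lra | right; apply/eqP; lra].
- by lra.
- by lra.
by rewrite good4 addr0.
Qed.

Lemma derivable_inv (z : C) : z != 0 -> derivable (fun w : C => w^-1) z 1.
Proof. by move=> z0; exact: (derivableV z0 (@derivable_id _ _ z 1)). Qed.

Lemma continuous_inv (z : C) : z != 0 -> {for z, continuous (fun w : C => w^-1)}.
Proof. by move=> /derivable_inv; exact: derivable_continuous. Qed.

Lemma inv_sides : continuous_on_sides (fun z : C => z^-1) (-1) 1 (-1) 1.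
Proof.
by apply: (continuous_on_square_sides ltr01) => x y _ _; exact: continuous_inv.
Qed.

Lemma winding_neq0 : winding != 0.
Proof.
pose u (t : R) : C := (2 / (1 + t ^+ 2))%:C.
have d0 (t : R) : 1 + t ^+ 2 != 0 by rewrite gt_eqF// ltr_pwDl// sqr_ge0.
have [s1 s2 s3 s4] := seg_integrable_sides inv_sides.
have e1 t : (1 +i* t : C)^-1 - ((-1) +i* t : C)^-1 = u t.
  apply: complex_eq; rewrite /= ?sqrrN ?expr1n; field; exact: d0.
have su : seg_integrable (-1) 1 u.
  by apply: eq_seg_integrable (seg_integrableB s4 s3) => t _; exact: e1.
have -> : winding = 2 * 'i * seg_integral (-1) 1 u.
  rewrite /winding /rect_contour.
  rewrite (@eq_seg_integral _ _ _ _ (fun t => 'i * u t)) => [|t _]; last first.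
    by apply: complex_eq; rewrite /= ?sqrrN ?expr1n;
      (field || ring); rewrite ?[_ ^+ 2 + 1]addrC ?d0 //.
  rewrite [X in _ + 'i * X](@eq_seg_integral _ _ _ _ u) => [|t _]; last exact: e1.
  by rewrite seg_integralZ//; ring.
rewrite !mulf_neq0//; first by rewrite eq_complex /= oner_eq0 andbF.
apply/eqP => /(congr1 (@complex.Re R)) /= h.
have : \int[@lebesgue_measure R]_(t in `[(-1)%R, 1%R]) (1 : R) <=
       \int[@lebesgue_measure R]_(t in `[(-1)%R, 1%R]) complex.Re (u t).
  apply: le_Rintegral => //; last first.
  - move=> t /=; rewrite in_itv /= => ht; rewrite ler_pdivlMr; last first.
      by rewrite ltr_pwDl// sqr_ge0.
    rewrite mul1r; nra.
  - by case: su.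
  - by have [] := seg_integrable_cst (-1) 1 (1 : C).
rewrite h Rintegral_cst//= lebesgue_measure_itv /= lte_fin.
by rewrite ifT ?mul1r //=; lra.
Qed.

Lemma eq_rect_contour f g (a b c d : R) : f =1 g ->
  rect_contour f a b c d = rect_contour g a b c d.
Proof. by move=> /funext ->. Qed.

(** Up to the factor [winding], Cauchy's formula for the derivative at 0. With
    [g 0] subtracted, constants are annihilated by construction; the classical
    integral of g z / z^2 is the same, since 1 / z^2 has the primitive -1 / z. *)
Definition cauchy_contour g : C :=
  rect_contour (fun z => (g z - g 0) * (z ^+ 2)^-1) (-1) 1 (-1) 1.

Lemma derivable_X2inv (z : C) : z != 0 ->
  derivable (fun w : C => (w ^+ 2)^-1) z 1.
Proof.
move=> z0; apply: (@derivableV _ _ (fun z : C => z ^+ 2)).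
  by rewrite expf_neq0.
rewrite (_ : (fun w : C => w ^+ 2) = (id : C -> C) * id).
  exact: (derivableM (@derivable_id _ _ z 1) (@derivable_id _ _ z 1)).
by apply/funext => w; rewrite expr2.
Qed.

Lemma cauchy_contour_sides g : unit_square (fun z => {for z, continuous g}) ->
  continuous_on_sides (fun z => (g z - g 0) * (z ^+ 2)^-1) (-1) 1 (-1) 1.
Proof.
move=> cg; apply: continuous_on_square_sides => // x y hx hy z0.
apply: (@continuousM _ _ (fun z => g z - g 0) (fun z => (z ^+ 2)^-1)).
  apply: (@continuousB _ _ _ g (cst (g 0))); [exact: cg|exact: cst_continuous].
exact: (derivable_continuous (derivable_X2inv z0)).
Qed.

Lemma cauchy_contourB f g : unit_square (fun z => {for z, continuous f}) ->
  unit_square (fun z => {for z, continuous g}) ->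
  cauchy_contour (fun z => f z - g z) = cauchy_contour f - cauchy_contour g.
Proof.
move=> /cauchy_contour_sides cf /cauchy_contour_sides cg.
rewrite /cauchy_contour -rect_contourB//.
by apply: eq_rect_contour => z; ring.
Qed.

Lemma cauchy_contourZ (k : C) g : unit_square (fun z => {for z, continuous g}) ->
  cauchy_contour (fun z => k * g z) = k * cauchy_contour g.
Proof.
move=> /cauchy_contour_sides cg; rewrite /cauchy_contour -rect_contourZ//.
by apply: eq_rect_contour => z; ring.
Qed.

Lemma cauchy_contour_bound g (M : R) : unit_square (fun z => {for z, continuous g}) ->
  unit_square (fun z => cabs (g z) <= M) -> cabs (cauchy_contour g) <= 32 * M.
Proof.
move=> cg gM; have M0 : cabs (g 0) <= M by apply: gM; lra.
have bd x y : -1 <= x <= 1 -> -1 <= y <= 1 ->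
    x = 1 \/ x = - 1 \/ y = 1 \/ y = - 1 ->
    cabs ((g (x +i* y) - g 0) * ((x +i* y) ^+ 2)^-1) <= 2 * M.
  move=> hx hy side; rewrite cabsM cabsV cabsX.
  have n1 := square_side_cabs_ge ler01 side.
  have n2 : 1 <= cabs (x +i* y : C) ^+ 2 by rewrite exprn_ege1.
  rewrite ler_pdivrMr ?(lt_le_trans ltr01)//.
  have := cabsB (g (x +i* y)) (g 0); have := gM _ _ hx hy.
  have := cabs_ge0 (g 0) => h0 h1 h2; nra.
have -> : 32 * M = 4 * (2 * M) * (1 - (-1) + (1 - (-1))) by ring.
apply: rect_contour_bound; [lra|lra|exact: cauchy_contour_sides| |] => t th;
  split; (apply: bd; [lra|lra|tauto]).
Qed.

(** The function (g z - g 0 - g'(0) z) / z^2 is o(1 / |z|) at 0, so its integral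
    over a square of side 2 s tends to 0 with s; by [rect_contour_shrink] the
    integral does not depend on s. *)
Theorem cauchy_contour_derive g : unit_square (fun z => derivable g z 1) ->
  cauchy_contour g = winding * 'D_1 g 0.
Proof.
move=> dg; set D := 'D_1 g 0.
have cg : unit_square (fun z => {for z, continuous g}).
  by move=> x y hx hy; apply: derivable_continuous; exact: dg.
pose p z := (g z - g 0) * (z ^+ 2)^-1 - D * z^-1.
have pE (z : C) : z != 0 -> p z = (g z - g 0 - D * z) * (z ^+ 2)^-1.
  by move=> z0; rewrite /p; field.
have dp : unit_square (fun z => z != 0 -> derivable p z 1).
  move=> x y hx hy z0.
  have d1 : derivable (fun z => g z - g 0) (x +i* y) 1.
    by apply: (@derivableB _ _ _ g (cst (g 0))); [exact: dg|exact: derivable_cst].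
  apply: (@derivableB _ _ _ (fun z => (g z - g 0) * (z ^+ 2)^-1) (fun z => D * z^-1)).
    exact: (derivableM d1 (derivable_X2inv z0)).
  exact: (derivableM (@derivable_cst _ _ _ D (x +i* y : C) 1) (derivable_inv z0)).
have sDinv : continuous_on_sides (fun z : C => D * z^-1) (-1) 1 (-1) 1.
  apply: (continuous_on_square_sides ltr01) => x y _ _ z0.
  exact: (derivable_continuous (derivableM (@derivable_cst _ _ _ D (x +i* y : C) 1)
    (derivable_inv z0))).
have pc : rect_contour p (-1) 1 (-1) 1 = cauchy_contour g - winding * D.
  rewrite (rect_contourB (cauchy_contour_sides cg) sDinv); congr (_ - _).
  by rewrite (rect_contourZ D inv_sides) mulrC.
apply/eqP; rewrite -subr_eq0 -pc -cabs_eq0 eq_le cabs_ge0 andbT.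
apply/ler_addgt0Pl => eta eta0; rewrite addr0.
have e0 : 0 < eta / 16 by rewrite divr_gt0.
have d0 : derivable g 0 1 by apply: (dg 0 0); lra.
have /near_complexP[r r0 hr] := derivable_approx d0 e0.
pose s := Num.min (r / 3) 1.
have s0 : 0 < s by rewrite lt_min divr_gt0//=.
have s1 : s <= 1 by rewrite ge_min lexx orbT.
have sr : 2 * s < r by have : s <= r / 3 by [rewrite ge_min lexx]; lra.
rewrite (rect_contour_shrink s0 s1 dp).
have bd x y : - s <= x <= s -> - s <= y <= s ->
    x = s \/ x = - s \/ y = s \/ y = - s -> cabs (p (x +i* y)) <= eta / 16 / s.
  move=> hx hy side; have zs := square_side_cabs_ge (ltW s0) side.
  have z0 := square_side_neq0 s0 side.
  have := hr (x +i* y); rewrite subr0 -/D.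
  move=> /(_ (le_lt_trans (square_cabs_le hx hy) sr)) h.
  rewrite pE// cabsM cabsV cabsX expr2 invfM mulrA.
  have zp : 0 < cabs (x +i* y : C) := lt_le_trans s0 zs.
  apply: (@le_trans _ _ (eta / 16 / cabs (x +i* y : C))).
    by rewrite ler_pM2r ?invr_gt0// ler_pdivrMr.
  by rewrite ler_pM2l// lef_pV2// posrE.
have -> : eta = 4 * (eta / 16 / s) * (s - - s + (s - - s)).
  by field; rewrite gt_eqF.
apply: rect_contour_bound; [lra|lra| | |].
- apply: (continuous_on_square_sides s0) => x y hx hy z0.
  by apply: derivable_continuous; apply: (dp _ _ _ _ z0); lra.
- by move=> t th; split; (apply: bd; [lra|lra|tauto]).
- by move=> t th; split; (apply: bd; [lra|lra|tauto]).
Qed.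

End CauchyKernel.
Arguments cauchy_contour : simpl never.
Arguments winding : simpl never.

(** * Directional derivatives in a complex normed space *)

Section RealNorm.
Context {R : realType} {W : normedModType R[i]}.
Local Notation C := R[i].
Implicit Types (u v w z : W).

(** The counterpart of [cabs] on a normed space over R[i]. *)
Definition rnorm (w : W) : R := complex.Re `|w|.
Arguments rnorm : simpl never.

Lemma rnormE w : `|w| = (rnorm w)%:C.
Proof.
rewrite /rnorm; have := normr_ge0 w; case: `|w| => x y.
by rewrite lecE /= => /andP[/eqP -> _].
Qed.

Lemma rnorm_ge0 w : 0 <= rnorm w.
Proof. by rewrite -lecR -rnormE; exact: normr_ge0. Qed.

Lemma rnormD u v : rnorm (u + v) <= rnorm u + rnorm v.
Proof. by rewrite -lecR rmorphD /= -!rnormE; exact: ler_normD. Qed.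

Lemma rnormZ (k : C) u : rnorm (k *: u) = cabs k * rnorm u.
Proof. by apply: complexI; rewrite rmorphM /= -!rnormE normrZ. Qed.

Lemma rnorm0 : rnorm 0 = 0. Proof. by rewrite /rnorm normr0. Qed.

Lemma rnorm_eq0 u : (rnorm u == 0) = (u == 0).
Proof.
apply/eqP/eqP => [h|->]; last exact: rnorm0.
by apply/eqP; rewrite -normr_eq0 rnormE h.
Qed.

Lemma near_normedP z (P : W -> Prop) :
  (\forall w \near z, P w) <->
  exists2 r : R, 0 < r & forall w, rnorm (w - z) < r -> P w.
Proof.
split.
  move/nbhs_ballP => [e /= /complex_gt0E[r r0 ->] h]; exists r => // w hw.
  by apply: h; rewrite -ball_normE /ball_ /= -opprB normrN rnormE ltcR.
move=> [r r0 h]; apply/nbhs_ballP; exists r%:C => /=; first by rewrite ltcR.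
by move=> w; rewrite -ball_normE /ball_ /= -opprB normrN rnormE ltcR => /h.
Qed.

End RealNorm.
Arguments rnorm : simpl never.

Section DirectionalDerivatives.
Context {R : realType} {W : normedModType R[i]}.
Local Notation C := R[i].
Implicit Types (u v w z h : W) (F : W -> C).

Lemma derive_lim F z v : derivable F z v ->
  (fun k : C => k^-1 * (F (k *: v + z) - F z)) @ 0^' --> 'D_v F z.
Proof. by []. Qed.

Lemma derivable_lim F z v (l : C) :
  (fun k : C => k^-1 * (F (k *: v + z) - F z)) @ 0^' --> l ->
  derivable F z v /\ 'D_v F z = l.
Proof.
move=> h; split; first by apply/cvg_ex; exists l.
exact: (cvg_lim (@norm_hausdorff _ _) h).
Qed.

Lemma derive_line F z v (k : C) : derivable F (z + k *: v) v ->
  derivable (fun t : C => F (z + t *: v)) k 1 /\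
  'D_1 (fun t : C => F (z + t *: v)) k = 'D_v F (z + k *: v).
Proof.
move=> dF; set g := fun t : C => F (z + t *: v).
have E : (fun t : C => t^-1 *: ((g \o shift k) (t *: 1) - g k)) =
    (fun t : C => t^-1 *: ((F \o shift (z + k *: v)) (t *: v) - F (z + k *: v))).
  apply/funext => t; rewrite /g /=.
  have -> : z + (t *: 1 + k) *: v = t *: v + (z + k *: v).
    by rewrite [t *: 1]mulr1 scalerDl addrCA.
  by [].
by split; [rewrite /derivable E|rewrite /derive E].
Qed.

Lemma derive_scale F z v (k : C) : derivable F z v ->
  derivable F z (k *: v) /\ 'D_(k *: v) F z = k * 'D_v F z.
Proof.
have [->|k0] := eqVneq k 0.
  move=> _; rewrite scale0r mul0r; split; [exact: derivable0|exact: derive0].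
move=> /derive_lim /cvg_complexP h; apply: derivable_lim; apply/cvg_complexP => e e0.
have ke0 : 0 < e / cabs k by rewrite divr_gt0// cabs_gt0.
have := h _ ke0; rewrite !near_withinE => /near_complexP[r r0 hr].
apply/near_complexP; exists (r / cabs k); first by rewrite divr_gt0// cabs_gt0.
move=> t; rewrite subr0 => tr t0.
have tk0 : t * k != 0 by rewrite mulf_neq0.
have := hr (t * k); rewrite subr0 cabsM -ltr_pdivlMr ?cabs_gt0// => /(_ tr tk0).
rewrite ltr_pdivlMr ?cabs_gt0// -cabsM scalerA; apply: le_lt_trans.
by rewrite le_eqVlt; apply/orP; left; apply/eqP; congr cabs; field; rewrite ?t0 ?k0.
Qed.

Lemma eq_near_derive F G z v : (\forall w \near z, F w = G w) ->
  derivable F z v -> derivable G z v /\ 'D_v G z = 'D_v F z.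
Proof.
move=> FG dF; split.
  exact: (@near_eq_derivable _ _ _ F G z v FG dF).
by apply/esym; exact: (@near_eq_derive _ _ _ F G z v FG).
Qed.

(** [P] stands for the real or the imaginary part: a complex directional
    derivative determines the real derivative of [P \o F] along the same line. *)
Lemma real_derive (P : C -> R) F z v (t : R) :
  (forall a b, P (a - b) = P a - P b) ->
  (forall (k : R) a, P (k%:C * a) = k * P a) ->
  (forall a, `|P a| <= cabs a) ->
  derivable F (z + t%:C *: v) v ->
  is_derive t 1 (fun s : R => P (F (z + s%:C *: v))) (P ('D_v F (z + t%:C *: v))).
Proof.
move=> PB PZ Pn /derive_lim /cvg_complexP h.
suff cv : (fun s : R => s^-1 *: (((fun s : R => P (F (z + s%:C *: v))) \o shift t)
    (s *: 1) - P (F (z + t%:C *: v)))) @ 0^' --> P ('D_v F (z + t%:C *: v)).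
  split; first by apply/cvg_ex; eexists; exact: cv.
  exact: (cvg_lim (@Rhausdorff _) cv).
apply/cvgrPdist_lt => e e0.
have := h e e0; rewrite !near_withinE => /near_complexP[r r0 hr].
near=> s => s0.
have sr : `|s| < r.
  by near: s; apply/nbhs_ballP; exists r => // s; rewrite /ball /= sub0r normrN.
have sC0 : s%:C != 0 :> C by rewrite eq_complex /= eqxx andbT.
have := hr s%:C; rewrite subr0 cabs_real => /(_ sr sC0).
apply: le_lt_trans; rewrite distrC.
set q := (X in cabs X); rewrite [X in `|X|](_ : _ = P q); first exact: Pn.
rewrite /q PB -fmorphV PZ PB /=.
have -> : s%:C *: v + (z + t%:C *: v) = z + (s *: 1 + t)%:C *: v.
  by rewrite [s *: 1]mulr1 rmorphD scalerDl addrCA.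
by [].
Unshelve. all: by end_near. Qed.

End DirectionalDerivatives.

(** * Derivatives of holomorphic functions are holomorphic *)

Section GateauxHolomorphic.
Context {R : realType} {W : normedModType R[i]}.
Local Notation C := R[i].
Implicit Types (u v w z h : W) (F : W -> C).

(** This notion reproduces itself under differentiation by arguments on complex
    lines; for Frechet differentiability one would also have to show that second
    derivatives are linear in the direction. *)
Definition gateaux_holo (U : set W) F : Prop :=
  forall z, U z -> {for z, continuous F} /\ forall v, derivable F z v.

(** The mean value theorem is applied to the two components, which need not share
    an intermediate point; hence the factor 2. *)
Lemma complex_mean_value F z h (k : C) (M : R) :
  (forall t : R, 0 <= t <= 1 -> derivable F (z + t%:C *: h) h /\
     cabs ('D_h F (z + t%:C *: h) - k) <= M) ->
  cabs (F (z + h) - F z - k) <= 2 * M.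
Proof.
move=> H.
have key (P : C -> R) : (forall a b, P (a - b) = P a - P b) ->
    (forall (r : R) a, P (r%:C * a) = r * P a) ->
    (forall a, `|P a| <= cabs a) -> `|P (F (z + h) - F z - k)| <= M.
  move=> PB PZ Pn; pose g (t : R) := P (F (z + t%:C *: h)).
  have dg (t : R) : 0 <= t <= 1 -> is_derive t 1 g (P ('D_h F (z + t%:C *: h))).
    by move=> /H[d _]; exact: real_derive PB PZ Pn d.
  have := @MVT_segment R g (fun t : R => P ('D_h F (z + t%:C *: h))) 0 1 ler01.
  case.
  - by move=> t; rewrite in_itv /= => /andP[t0 t1]; apply: dg; rewrite !ltW.
  - apply: derivable_within_continuous => t; rewrite in_itv /= => tI.
    by have [] := dg t tI.
  move=> c; rewrite in_itv /= => cI.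
  rewrite /g scale1r scale0r addr0 subr0 mulr1 !PB => ->.
  by rewrite -PB; apply: (le_trans (Pn _)); have [] := H c cI.
apply: (le_trans (cabs_le_ReIm _)).
have -> : 2 * M = M + M by ring.
apply: lerD; apply: key.
- exact: ReB.
- by move=> r a; rewrite ReM /= mul0r subr0.
- exact: Re_le_cabs.
- exact: ImB.
- by move=> r a; rewrite ImM /= mul0r addr0.
- exact: Im_le_cabs.
Qed.

Lemma rnorm_segment u v z (t r : R) : 0 <= t <= 1 -> rnorm (u - z) < r ->
  rnorm (v - z) < r -> rnorm (u + t%:C *: (v - u) - z) < r.
Proof.
move=> /andP[t0 t1] ur vr.
have -> : u + t%:C *: (v - u) - z = (1 - t)%:C *: (u - z) + t%:C *: (v - z).
  have -> : v - u = (v - z) - (u - z) by rewrite opprB addrA subrK.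
  rewrite [LHS]addrAC scalerBr rmorphB /= scalerBl scale1r.
  by rewrite [X in _ + X]addrC addrA.
apply: (le_lt_trans (rnormD _ _)); rewrite !rnormZ !cabs_real !ger0_norm ?subr_ge0//.
have := rnorm_ge0 (u - z); have := rnorm_ge0 (v - z) => h1 h2.
have -> : r = (1 - t) * r + t * r by ring.
have [->|tn0] := eqVneq t 0; first by rewrite subr0 !mul0r !mul1r !addr0.
have tp : 0 < t by rewrite lt_def tn0.
by apply: ler_ltD; [apply: ler_wpM2l; rewrite ?subr_ge0// ltW|rewrite ltr_pM2l].
Qed.

Lemma quotient_rearrange (a b c l k : C) : l != 0 -> k != 0 ->
  l * a - l * b - k * c = l * k * (k^-1 * (a - b) - l^-1 * c).
Proof. by move=> l0 k0; field; rewrite l0 k0. Qed.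

(** Local estimates around [z0]. The radius 4 rho leaves room for two successive
    steps: each application of Cauchy's formula at [z] involves the points
    [z + t *: v] with t in the unit square, where |t| <= 2. *)
Section Local.
Context (F : W -> C) (z0 : W) (rho B : R).
Context (rho0 : 0 < rho).
Context (good : forall u, rnorm (u - z0) < 4 * rho ->
  [/\ forall v, derivable F u v, {for u, continuous F} & cabs (F u) <= B]).

Let kappa : R := cabs (winding : C).
Let kappa0 : 0 < kappa. Proof. by rewrite /kappa cabs_gt0 winding_neq0. Qed.

Let B0 : 0 <= B.
Proof.
have [|_ _] := good (u := z0); first by rewrite subrr rnorm0 mulr_gt0.
exact: le_trans (cabs_ge0 _).
Qed.

Let line_near z v (t : C) (s : R) : rnorm (z - z0) < s -> cabs t * rnorm v <= 4 * rho - s ->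
  rnorm (z + t *: v - z0) < 4 * rho.
Proof.
move=> zs tv; rewrite addrAC; apply: (le_lt_trans (rnormD _ _)); rewrite rnormZ; lra.
Qed.

Let square_le (x y : R) : -1 <= x <= 1 -> -1 <= y <= 1 -> cabs (x +i* y : C) <= 2.
Proof. by move=> hx hy; have := square_cabs_le hx hy; rewrite mulr1. Qed.

Let square_line z v (s : R) (x y : R) : rnorm (z - z0) < s -> 2 * rnorm v <= 4 * rho - s ->
  -1 <= x <= 1 -> -1 <= y <= 1 -> rnorm (z + (x +i* y) *: v - z0) < 4 * rho.
Proof.
move=> zs vs hx hy; apply: line_near zs _; apply: le_trans vs.
by apply: ler_wpM2r; [exact: rnorm_ge0|exact: square_le].
Qed.

Let cauchy_line z v (s : R) : rnorm (z - z0) < s -> 2 * rnorm v <= 4 * rho - s ->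
  [/\ unit_square (fun t : C => derivable (fun t : C => F (z + t *: v)) t 1),
      unit_square (fun t : C => {for t, continuous (fun t : C => F (z + t *: v))}) &
      cauchy_contour (fun t : C => F (z + t *: v)) = winding * 'D_v F z].
Proof.
move=> zs vs.
have d : unit_square (fun t : C => derivable (fun t : C => F (z + t *: v)) t 1).
  move=> x y hx hy; have [dF _ _] := good (square_line zs vs hx hy).
  by have [] := derive_line (dF v).
split; first exact: d.
  by move=> x y hx hy; exact: (derivable_continuous (d x y hx hy)).
have dz : derivable F (z + 0 *: v) v.
  have [dF _ _] := good (square_line zs vs (x := 0) (y := 0) ltac:(lra) ltac:(lra)).
  exact: dF.
have [_ dE] := derive_line dz.
by rewrite (cauchy_contour_derive d) dE scale0r addr0.
Qed.

Let L1 := 32 * B / (kappa * rho).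
Let L10 : 0 <= L1.
Proof. by rewrite divr_ge0 ?mulr_ge0// ltW. Qed.

Let good_derivable z v (s : R) : rnorm (z - z0) < s -> s <= 4 * rho -> derivable F z v.
Proof.
by move=> zs s4; have [dF _ _] := good (lt_le_trans zs s4); exact: dF.
Qed.

Let rho24 : 2 * rho <= 4 * rho. Proof. by rewrite ler_pM2r// ler_nat. Qed.
Let rho14 : rho <= 4 * rho.
Proof. by rewrite -[X in X <= _]mul1r ler_pM2r// ler1n. Qed.

(** Cauchy's formula for the direction [v] rescaled to length [rho]. *)
Lemma derive_bound z v : rnorm (z - z0) < 2 * rho -> cabs ('D_v F z) <= L1 * rnorm v.
Proof.
move=> z2; have [v0|v0] := eqVneq v 0.
  by rewrite v0 derive0 cabs0 rnorm0 mulr0.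
have rv0 : 0 < rnorm v by rewrite lt_def rnorm_eq0 v0 rnorm_ge0.
pose k := rho / rnorm v.
have k0 : 0 < k by rewrite divr_gt0.
have rkv : rnorm (k%:C *: v) = rho.
  by rewrite rnormZ cabs_real gtr0_norm// /k; field; rewrite gt_eqF.
have vs : 2 * rnorm (k%:C *: v) <= 4 * rho - 2 * rho by rewrite rkv; lra.
have [_ cg cE] := cauchy_line z2 vs.
have : cabs (cauchy_contour (fun t : C => F (z + t *: (k%:C *: v)))) <= 32 * B.
  apply: (cauchy_contour_bound cg) => x y hx hy.
  by have [] := good (square_line z2 vs hx hy).
have dz : derivable F z v := @good_derivable _ v _ z2 rho24.
rewrite cE; have [_ ->] := derive_scale k%:C dz.
rewrite !cabsM cabs_real gtr0_norm// -/kappa => h.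
rewrite /L1 mulrAC ler_pdivlMr ?mulr_gt0//.
have -> : cabs ('D_v F z) * (kappa * rho) = kappa * (k * cabs ('D_v F z)) * rnorm v.
  by rewrite /k; field; rewrite gt_eqF.
by rewrite ler_pM2r.
Qed.

Lemma lipschitz z z' : rnorm (z - z0) < 2 * rho -> rnorm (z' - z0) < 2 * rho ->
  cabs (F z' - F z) <= 2 * L1 * rnorm (z' - z).
Proof.
move=> zr z'r.
have := @complex_mean_value F z (z' - z) 0 (L1 * rnorm (z' - z)).
rewrite subr0 addrCA subrr addr0 mulrA; apply => t t01; rewrite subr0.
have tr := rnorm_segment t01 zr z'r; split; last exact: derive_bound.
exact: (@good_derivable _ _ _ tr rho24).
Qed.

Let L2 := 128 * L1 / (kappa * rho).
Let L20 : 0 <= L2.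
Proof.
by apply: divr_ge0; [exact: mulr_ge0 | apply: mulr_ge0; exact: ltW].
Qed.

(** Cauchy's formula for the difference of two translates of [F], which
    [lipschitz] bounds. *)
Lemma derive_lipschitz z z' v : rnorm (z - z0) < rho -> rnorm (z' - z0) < rho ->
  cabs ('D_v F z' - 'D_v F z) <= L2 * rnorm v * rnorm (z' - z).
Proof.
move=> zr z'r; have [v0|v0] := eqVneq v 0.
  by rewrite v0 !derive0 subrr cabs0 rnorm0 mulr0 mul0r.
have rv0 : 0 < rnorm v by rewrite lt_def rnorm_eq0 v0 rnorm_ge0.
pose k := rho / (2 * rnorm v).
have k0 : 0 < k by rewrite divr_gt0// mulr_gt0.
have rkv : rnorm (k%:C *: v) = rho / 2.
  by rewrite rnormZ cabs_real gtr0_norm// /k; field; rewrite gt_eqF.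
have vs : 2 * rnorm (k%:C *: v) <= 4 * rho - rho by rewrite rkv; have := rho0; lra.
have [_ cg cE] := cauchy_line zr vs.
have [_ cg' cE'] := cauchy_line z'r vs.
have cgg : unit_square (fun s : C => {for s, continuous
   (fun t : C => F (z' + t *: (k%:C *: v)) - F (z + t *: (k%:C *: v)))}).
  move=> x y hx hy; exact: (continuousB (cg' x y hx hy) (cg x y hx hy)).
have in2 u (x y : R) : rnorm (u - z0) < rho -> -1 <= x <= 1 -> -1 <= y <= 1 ->
    rnorm (u + (x +i* y) *: (k%:C *: v) - z0) < 2 * rho.
  move=> ur hx hy; rewrite addrAC; apply: (le_lt_trans (rnormD _ _)).
  rewrite rnormZ rkv (_ : 2 * rho = rho + rho); last by ring.
  apply: ltr_leD => //; have := square_le hx hy; have := rho0; nra.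
have : cabs (cauchy_contour (fun t : C =>
    F (z' + t *: (k%:C *: v)) - F (z + t *: (k%:C *: v))))
    <= 32 * (2 * L1 * rnorm (z' - z)).
  apply: (cauchy_contour_bound cgg) => x y hx hy.
  have := lipschitz (in2 _ _ _ zr hx hy) (in2 _ _ _ z'r hx hy).
  by rewrite opprD addrACA subrr addr0.
rewrite (cauchy_contourB cg' cg) cE cE' -mulrBr.
have [_ ->] := derive_scale k%:C (@good_derivable _ v _ zr rho14).
have [_ ->] := derive_scale k%:C (@good_derivable _ v _ z'r rho14).
rewrite -mulrBr !cabsM cabs_real gtr0_norm// -/kappa => h.
have -> : L2 * rnorm v * rnorm (z' - z) =
    128 * L1 * rnorm v * rnorm (z' - z) / (kappa * rho) by rewrite /L2; ring.
rewrite ler_pdivlMr ?mulr_gt0//.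
have -> : cabs ('D_v F z' - 'D_v F z) * (kappa * rho) =
   kappa * (k * cabs ('D_v F z' - 'D_v F z)) * (2 * rnorm v).
  by rewrite /k; field; rewrite gt_eqF.
have -> : 128 * L1 * rnorm v * rnorm (z' - z) =
  32 * (2 * L1 * rnorm (z' - z)) * (2 * rnorm v) by ring.
by rewrite ler_pM2r// mulr_gt0.
Qed.

Lemma second_order z h : rnorm (z - z0) < rho -> rnorm (z + h - z0) < rho ->
  cabs (F (z + h) - F z - 'D_h F z) <= 2 * (L2 * rnorm h * rnorm h).
Proof.
move=> zr zhr; apply: complex_mean_value => t t01.
have := rnorm_segment t01 zr zhr; rewrite [z + h - z]addrAC subrr add0r => tr.
split; first exact: (@good_derivable _ _ _ tr rho14).
apply: (le_trans (derive_lipschitz _ zr tr)).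
rewrite [z + _ - z]addrAC subrr add0r rnormZ cabs_real.
apply: ler_wpM2l; first by rewrite mulr_ge0// rnorm_ge0.
have /andP[t0 t1] := t01.
by rewrite ger0_norm// ler_piMl// rnorm_ge0.
Qed.

Lemma derive_continuous v : {for z0, continuous ('D_v F)}.
Proof.
apply/cvg_complexP => e e0; apply/near_normedP.
pose A := L2 * rnorm v.
have A0 : 0 <= A by rewrite mulr_ge0// rnorm_ge0.
exists (Num.min rho (e / (A + 1))).
  by rewrite lt_min rho0 divr_gt0// ltr_wpDl.
move=> w; rewrite lt_min => /andP[w1 w2].
have z0r : rnorm (z0 - z0) < rho by rewrite subrr rnorm0.
apply: (le_lt_trans (derive_lipschitz v z0r w1)); rewrite -/A.
have : (A + 1) * rnorm (w - z0) < e by rewrite mulrC -ltr_pdivlMr// ltr_wpDl.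
by apply: le_lt_trans; rewrite ler_wpM2r ?rnorm_ge0// lerDl.
Qed.

(** By Cauchy's formula the derivative of 'D_v F in the direction [h] should be
    the Cauchy integral of t |-> 'D_h F (z0 + t v); [second_order], applied under
    the integral, shows that it is. *)
Let derive_derivable_small v h : rnorm v <= rho / 4 -> derivable ('D_v F) z0 h.
Proof.
move=> vr.
have z0r : rnorm (z0 - z0) < rho by rewrite subrr rnorm0.
have vs : 2 * rnorm v <= 4 * rho - rho by have := rho0; lra.
have in1 (t : C) : cabs t < 3 -> rnorm (z0 + t *: v - z0) < rho.
  move=> t3; rewrite addrAC subrr add0r rnormZ.
  have := cabs_ge0 t; have := rnorm_ge0 v; have := rho0; nra.
have in1s (x y : R) : -1 <= x <= 1 -> -1 <= y <= 1 -> cabs (x +i* y : C) < 3.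
  by move=> hx hy; apply: (le_lt_trans (square_le hx hy)); lra.
have cD : unit_square (fun t : C =>
    {for t, continuous (fun t : C => 'D_h F (z0 + t *: v))}).
  move=> x y hx hy.
  apply/(@cvg_complexP _ _ _ (nbhs_filter (x +i* y : C))) => e e0; apply/near_complexP.
  pose A := L2 * rnorm h * rnorm v.
  have A0 : 0 <= A := mulr_ge0 (mulr_ge0 L20 (rnorm_ge0 h)) (rnorm_ge0 v).
  exists (Num.min 1 (e / (A + 1))).
    by rewrite lt_min ltr01 divr_gt0// ltr_wpDl.
  move=> t; rewrite lt_min => /andP[t1 t2].
  have t3 : cabs t < 3.
    rewrite -(subrK (x +i* y) t); apply: (le_lt_trans (cabsD _ _)).
    have := square_le hx hy; lra.
  apply: (le_lt_trans (derive_lipschitz h (in1 _ (in1s _ _ hx hy)) (in1 _ t3))).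
  rewrite opprD addrACA subrr add0r -scalerBl rnormZ.
  have : (A + 1) * cabs (t - (x +i* y)) < e by rewrite mulrC -ltr_pdivlMr// ltr_wpDl.
  apply: le_lt_trans; rewrite /A; have := cabs_ge0 (t - (x +i* y)); lra.
pose l := winding^-1 * cauchy_contour (fun t : C => 'D_h F (z0 + t *: v)).
suff : (fun k : C => k^-1 * ('D_v F (k *: h + z0) - 'D_v F z0)) @ 0^' --> l.
  by move=> lim; have [] := @derivable_lim _ _ ('D_v F) z0 h l lim.
apply/cvg_complexP => e e0; rewrite near_withinE; apply/near_complexP.
pose A := 64 * L2 * rnorm h ^+ 2 / kappa.
have A0 : 0 <= A.
  exact: (divr_ge0 (mulr_ge0 (mulr_ge0 (ler0n _ 64) L20) (sqr_ge0 _)) (ltW kappa0)).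
(* The first bound keeps all points in the ball where [second_order] holds, the
   second makes the resulting error A |k| smaller than e. *)
exists (Num.min (rho / (2 * (rnorm h + 1))) (e / (A + 1))).
  rewrite lt_min !divr_gt0 ?mulr_gt0 ?ltr_wpDl ?rnorm_ge0//.
move=> k; rewrite subr0 lt_min => /andP[k1 k2] k0.
have khr : cabs k * rnorm h < rho / 2.
  have h10 : 0 < 2 * (rnorm h + 1) by rewrite mulr_gt0 ?ltr_wpDl ?rnorm_ge0.
  move: k1; rewrite ltr_pdivlMr// => k1; have := cabs_ge0 k; lra.
have z1r : rnorm (k *: h + z0 - z0) < rho.
  by rewrite addrK rnormZ; have := rho0; lra.
have [_ c0 E0] := cauchy_line z0r vs.
have [_ c1 E1] := cauchy_line z1r vs.
have ckD : unit_square (fun t : C =>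
    {for t, continuous (fun t : C => k * 'D_h F (z0 + t *: v))}).
  move=> x y hx hy.
  exact: (continuousM (@cst_continuous _ _ k (x +i* y : C)) (cD x y hx hy)).
have c10 : unit_square (fun t : C => {for t, continuous
    (fun t : C => F (k *: h + z0 + t *: v) - F (z0 + t *: v))}).
  by move=> x y hx hy; exact: (continuousB (c1 x y hx hy) (c0 x y hx hy)).
have call : unit_square (fun t : C => {for t, continuous
    (fun t : C => F (k *: h + z0 + t *: v) - F (z0 + t *: v)
              - k * 'D_h F (z0 + t *: v))}).
  by move=> x y hx hy; exact: (continuousB (c10 x y hx hy) (ckD x y hx hy)).
have : cabs (cauchy_contour (fun t : C => F (k *: h + z0 + t *: v) - F (z0 + t *: v)
              - k * 'D_h F (z0 + t *: v))) <=
    32 * (2 * (L2 * (cabs k * rnorm h) * (cabs k * rnorm h))).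
  apply: (cauchy_contour_bound call) => x y hx hy.
  have zt : rnorm (z0 + (x +i* y) *: v - z0) < rho by apply: in1; exact: in1s.
  have zkt : rnorm (z0 + (x +i* y) *: v + k *: h - z0) < rho.
    rewrite [_ + k *: h]addrC -addrA; apply: (le_lt_trans (rnormD _ _)).
    rewrite rnormZ addrAC subrr add0r rnormZ.
    have := square_le hx hy; have := cabs_ge0 (x +i* y); have := rnorm_ge0 v; nra.
  have := second_order zt zkt; rewrite rnormZ.
  have [_ ->] := derive_scale k (@good_derivable _ h _ zt rho14).
  by rewrite [_ + k *: h]addrC addrA.
rewrite (cauchy_contourB c10 ckD) (cauchy_contourB c1 c0) (cauchy_contourZ k cD) E0 E1.
have -> : winding * 'D_v F (k *: h + z0) - winding * 'D_v F z0 -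
    k * cauchy_contour (fun t : C => 'D_h F (z0 + t *: v)) =
    winding * k * (k^-1 * ('D_v F (k *: h + z0) - 'D_v F z0) - l).
  exact: (quotient_rearrange _ _ _ winding_neq0 k0).
rewrite !cabsM -/kappa => bd.
have nk0 : 0 < cabs k by rewrite cabs_gt0.
have : (A + 1) * cabs k < e by rewrite mulrC -ltr_pdivlMr// ltr_wpDl.
apply: le_lt_trans; apply: (@le_trans _ _ (A * cabs k)); last first.
  by rewrite ler_pM2r// lerDl.
rewrite -(ler_pM2l (mulr_gt0 kappa0 nk0)); apply: (le_trans bd).
rewrite le_eqVlt; apply/orP; left; apply/eqP.
by rewrite /A; field; rewrite gt_eqF.
Qed.

Lemma derive_derivable v h : derivable ('D_v F) z0 h.
Proof.
pose k := rho / (4 * (rnorm v + 1)).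
have v1 : 0 < rnorm v + 1 by rewrite ltr_wpDl ?rnorm_ge0.
have k0 : 0 < k by rewrite divr_gt0// mulr_gt0.
have kv : rnorm (k%:C *: v) <= rho / 4.
  rewrite rnormZ cabs_real gtr0_norm// /k mulrAC ler_pdivrMr ?mulr_gt0//.
  have -> : rho / 4 * (4 * (rnorm v + 1)) = rho * (rnorm v + 1) by field.
  by rewrite ler_pM2l// lerDl.
have kC0 : k%:C != 0 :> C by rewrite eq_complex /= eqxx andbT gt_eqF.
have E : \forall w \near z0, k%:C^-1 * 'D_(k%:C *: v) F w = 'D_v F w.
  apply/near_normedP; exists rho => // w wr.
  have [_ ->] := derive_scale k%:C (@good_derivable _ v _ wr rho14).
  by rewrite mulKf.
have d : derivable (cst (k%:C^-1 : C) * 'D_(k%:C *: v) F) z0 h.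
  apply: derivableM; [exact: derivable_cst|exact: derive_derivable_small].
exact: (@eq_near_derive _ _ (cst (k%:C^-1 : C) * 'D_(k%:C *: v) F) _ _ _ E d).1.
Qed.

End Local.

(** Continuity at [z] supplies the local bound from which the estimates start. *)
Theorem gateaux_holo_derive (U : set W) F v :
  open U -> gateaux_holo U F -> gateaux_holo U ('D_v F).
Proof.
move=> oU FU z0 Uz0.
have cF := (FU z0 Uz0).1.
have : \forall u \near z0, U u /\ cabs (F u - F z0) < 1.
  apply: filterI; first exact: open_nbhs_nbhs.
  by move/cvg_complexP: cF => /(_ 1 ltr01).
move=> /near_normedP[r r0 hr].
have rho0 : 0 < r / 4 by rewrite divr_gt0.
have r4 : 4 * (r / 4) = r by field.
have good u : rnorm (u - z0) < 4 * (r / 4) ->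
    [/\ forall v, derivable F u v, {for u, continuous F} & cabs (F u) <= cabs (F z0) + 1].
  rewrite r4 => /hr[Uu Fu]; have [c d] := FU u Uu; split; [exact: d|exact: c|].
  rewrite -(subrK (F z0) (F u)) addrC; apply: (le_trans (cabsD _ _)).
  by rewrite lerD2l ltW.
split=> [|h].
  exact: (@derive_continuous _ _ _ _ rho0 good v).
exact: (@derive_derivable _ _ _ _ rho0 good v h).
Qed.

End GateauxHolomorphic.

(** * Smoothness in real coordinates *)

Section SmoothRestriction.
Context {R : realType}.
Local Notation C := R[i].

Lemma eq_Ck {E F : normedModType R} k (A : set E) (f g : E -> F) : open A ->
  (forall x, A x -> f x = g x) -> Ck k A f -> Ck k A g.
Proof.
move=> oA; elim: k f g => [|k IH] f g fg /= [cf df].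
  split; last exact: I.
  move=> x Ax; have fgx : \forall y \near x, f y = g y.
    by apply: filterS (open_nbhs_nbhs (conj oA Ax)) => y; exact: fg.
  have fx := cf x Ax; rewrite /prop_for /continuous_at -(fg x Ax).
  exact: (cvg_trans (near_eq_cvg fgx) fx).
have fgx x : A x -> \forall y \near x, f y = g y.
  by move=> Ax; apply: filterS (open_nbhs_nbhs (conj oA Ax)) => y; exact: fg.
split.
  move=> x Ax; have fx := cf x Ax; rewrite /prop_for /continuous_at -(fg x Ax).
  exact: (cvg_trans (near_eq_cvg (fgx x Ax)) fx).
move=> v; have [d1 d2] := df v; split.
  by move=> x Ax; apply: near_eq_derivable (fgx x Ax) (d1 x Ax).
apply: IH d2 => x Ax; exact: near_eq_derive (fgx x Ax).
Qed.

Context {E : normedModType R} {W : normedModType R[i]}.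

(** The derivative of P (F (L p)) in the direction v is P ('D_(L v) F (L p)), of
    the same form with another holomorphic function in place of [F]. *)
Lemma Ck_restriction (P : C -> R) (L : E -> W) (U : set W) (A : set E) :
  (forall a b, P (a - b) = P a - P b) ->
  (forall (k : R) a, P (k%:C * a) = k * P a) ->
  (forall a, `|P a| <= cabs a) ->
  (forall (t : R) p q, L (t *: q + p) = t%:C *: L q + L p) ->
  continuous L -> open U -> open A -> (forall p, A p -> U (L p)) ->
  forall k (F : W -> C), gateaux_holo U F -> Ck k A (fun p => P (F (L p))).
Proof.
move=> PB PZ Pn LP cL oU oA AU.
have cont F : gateaux_holo U F -> forall p, A p ->
    {for p, continuous (fun p => P (F (L p)))}.
  move=> FU p Ap; have [cF _] := FU _ (AU p Ap).
  have cFL : F (L q) @[q --> p] --> F (L p) := cvg_comp _ _ (cL p) cF.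
  apply/cvgrPdist_lt => e e0.
  apply: filterS (((@cvg_complexP _ _ _ (nbhs_filter p) (F \o L) _).1 cFL) e e0) => q.
  by apply: le_lt_trans; rewrite distrC -PB Pn.
have dir F v p : gateaux_holo U F -> A p ->
    is_derive p v (fun p => P (F (L p))) (P ('D_(L v) F (L p))).
  move=> FU Ap; have [_ dF] := FU _ (AU p Ap).
  have dF0 : derivable F (L p + (0 : R)%:C *: L v) (L v).
    by rewrite scale0r addr0; exact: dF.
  have [d1 d2] := real_derive PB PZ Pn dF0.
  have EQ : (fun h : R => h^-1 *: (((fun p => P (F (L p))) \o shift p) (h *: v)
        - P (F (L p)))) =
     (fun h : R => h^-1 *: (((fun s : R => P (F (L p + s%:C *: L v))) \o shift 0) (h *: 1)
        - P (F (L p + (0 : R)%:C *: L v)))).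
    apply/funext => h; rewrite /= LP scale0r !addr0 [h *: 1]mulr1.
    by rewrite [_ + L p]addrC.
  split; first by rewrite /derivable EQ; exact: d1.
  have E0 : L p + (0 : R)%:C *: L v = L p by rewrite scale0r addr0.
  rewrite /derive EQ.
  exact: (etrans d2 (congr1 (fun z => P ('D_(L v) F z)) E0)).
elim=> [|k IH] F FU; first by split; [exact: cont|exact: I].
split; [exact: cont|move=> v; split].
  by move=> p Ap; have [] := dir F v p FU Ap.
apply: (@eq_Ck _ _ _ _ (fun p => P ('D_(L v) F (L p))) _ oA).
  by move=> p Ap; have [_ ->] := dir F v p FU Ap.
exact: (IH _ (@gateaux_holo_derive _ _ U F (L v) oU FU)).
Qed.

End SmoothRestriction.

Section GholoAlgebra.
Context {R : realType} {W : normedModType R[i]}.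
Local Notation C := R[i].
Implicit Types (U : set W) (F G : W -> C).

Lemma gateaux_holo_cst U (c : C) : gateaux_holo U (cst c).
Proof. by move=> z _; split=> [|v]; [exact: cst_continuous|exact: derivable_cst]. Qed.

Lemma gateaux_holoD U F G : gateaux_holo U F -> gateaux_holo U G -> gateaux_holo U (F + G).
Proof.
move=> hF hG z Uz; have [cF dF] := hF z Uz; have [cG dG] := hG z Uz.
by split=> [|v]; [exact: (continuousD cF cG)|exact: (derivableD (dF v) (dG v))].
Qed.

Lemma gateaux_holoM U F G : gateaux_holo U F -> gateaux_holo U G -> gateaux_holo U (F * G).
Proof.
move=> hF hG z Uz; have [cF dF] := hF z Uz; have [cG dG] := hG z Uz.
by split=> [|v]; [exact: (continuousM cF cG)|exact: (derivableM (dF v) (dG v))].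
Qed.

Lemma gateaux_holoV U F : (forall z, U z -> F z != 0) -> gateaux_holo U F ->
  gateaux_holo U (fun z => (F z)^-1).
Proof.
move=> F0 hF z Uz; have [cF dF] := hF z Uz; split=> [|v].
  exact: (cvg_comp _ _ cF (continuous_inv (F0 z Uz))).
exact: (derivableV (F0 z Uz) (dF v)).
Qed.

Lemma gateaux_holo_sum U (I : Type) (r : seq I) (P : pred I) (F : I -> W -> C) :
  (forall i, P i -> gateaux_holo U (F i)) ->
  gateaux_holo U (fun z => \sum_(i <- r | P i) F i z).
Proof.
move=> hF; elim: r => [|i r IH].
  rewrite (_ : (fun _ => _) = cst 0); first exact: gateaux_holo_cst.
  by apply/funext => z; rewrite big_nil.
case Pi : (P i); last first.
  rewrite (_ : (fun _ => _) = (fun z => \sum_(i <- r | P i) F i z)); first exact: IH.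
  by apply/funext => z; rewrite big_cons Pi.
rewrite (_ : (fun _ => _) = F i + (fun z => \sum_(i <- r | P i) F i z)).
  exact: (gateaux_holoD (hF i Pi) IH).
by apply/funext => z; rewrite big_cons Pi.
Qed.

Lemma gateaux_holo_prod U (I : Type) (r : seq I) (P : pred I) (F : I -> W -> C) :
  (forall i, P i -> gateaux_holo U (F i)) ->
  gateaux_holo U (fun z => \prod_(i <- r | P i) F i z).
Proof.
move=> hF; elim: r => [|i r IH].
  rewrite (_ : (fun _ => _) = cst 1); first exact: gateaux_holo_cst.
  by apply/funext => z; rewrite big_nil.
case Pi : (P i); last first.
  rewrite (_ : (fun _ => _) = (fun z => \prod_(i <- r | P i) F i z)); first exact: IH.
  by apply/funext => z; rewrite big_cons Pi.
rewrite (_ : (fun _ => _) = F i * (fun z => \prod_(i <- r | P i) F i z)).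
  exact: (gateaux_holoM (hF i Pi) IH).
by apply/funext => z; rewrite big_cons Pi.
Qed.

Lemma gateaux_holo_det U n (M : W -> 'M[C]_n) :
  (forall i j, gateaux_holo U (fun z => M z i j)) -> gateaux_holo U (fun z => \det (M z)).
Proof.
move=> hM; apply: gateaux_holo_sum => s _.
apply: gateaux_holoM; first exact: gateaux_holo_cst.
by apply: gateaux_holo_prod => i _; exact: hM.
Qed.

Lemma eq_gateaux_holo U F G : open U -> (forall z, U z -> F z = G z) ->
  gateaux_holo U F -> gateaux_holo U G.
Proof.
move=> oU FG hF z Uz; have [cF dF] := hF z Uz.
have near_FG : \forall w \near z, F w = G w.
  by apply: filterS (open_nbhs_nbhs (conj oU Uz)) => w; exact: FG.
split=> [|v]; last exact: (eq_near_derive near_FG (dF v)).1.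
rewrite /prop_for /continuous_at -(FG z Uz).
exact: (cvg_trans (near_eq_cvg near_FG) cF).
Qed.

(** Cramer's rule. *)
Lemma gateaux_holo_invmx U n (M : W -> 'M[C]_n) : open U ->
  (forall z, U z -> M z \in unitmx) ->
  (forall i j, gateaux_holo U (fun z => M z i j)) ->
  forall i j, gateaux_holo U (fun z => invmx (M z) i j).
Proof.
move=> oU uM hM i j.
apply: (@eq_gateaux_holo _ ((fun z => (\det (M z))^-1) * (fun z => \adj (M z) i j)) _ oU).
  by move=> z Uz; rewrite /invmx uM// mxE.
apply: gateaux_holoM.
  apply: gateaux_holoV; last exact: gateaux_holo_det.
  by move=> z /uM; rewrite unitmxE unitfE.
apply: (@eq_gateaux_holo _ ((cst ((-1) ^+ (j + i))) *
    (fun z => \det (row' j (col' i (M z))))) _ oU).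
  by move=> z _; rewrite mxE.
apply: gateaux_holoM; first exact: gateaux_holo_cst.
apply: gateaux_holo_det => k l.
by apply: (@eq_gateaux_holo _ _ _ oU _ (hM (lift j k) (lift i l))) => z _; rewrite !mxE.
Qed.

End GholoAlgebra.

(** * Inner products of holomorphic and antiholomorphic maps *)

Section InnerProduct.
Context {R : realType} {V : completeNormedModType R[i]}.
Context (dot : {dot V for @Num.conj R[i]}).
Context (norm_dot : forall f : V, `|f| ^+ 2 = dot f f).
Local Notation C := R[i].

Lemma dotC (u v : V) : dot u v = Num.conj (dot v u).
Proof. by rewrite (hermC dot) expr0 mul1r. Qed.

Lemma dotZl (k : C) (u v : V) : dot (k *: u) v = k * dot u v.
Proof. exact: linearZl_LR. Qed.

Lemma dotZr (k : C) (u v : V) : dot u (k *: v) = Num.conj k * dot u v.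
Proof. exact: linearZr_LR. Qed.

Lemma dotBl (u v w : V) : dot (u - v) w = dot u w - dot v w.
Proof. exact: linearBl. Qed.

Lemma dotBr (u v w : V) : dot u (v - w) = dot u v - dot u w.
Proof. exact: linearBr. Qed.

Lemma dotDr (u v w : V) : dot u (v + w) = dot u v + dot u w.
Proof. exact: linearDr. Qed.

Lemma dot_suml (I : Type) (r : seq I) (f : I -> V) (v : V) :
  dot (\sum_(i <- r) f i) v = \sum_(i <- r) dot (f i) v.
Proof. exact: linear_sumlz. Qed.

Lemma dot_sumr (I : Type) (r : seq I) (f : I -> V) (v : V) :
  dot v (\sum_(i <- r) f i) = \sum_(i <- r) dot v (f i).
Proof. exact: linear_sumr. Qed.

Lemma dot_eq0 (u : V) : dot u u = 0 -> u = 0.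
Proof. by move=> /eqP; rewrite dnorm_eq0 => /eqP. Qed.

(** Split u into its projection on v and an orthogonal remainder. *)
Lemma cauchy_schwarz (u v : V) : `|dot u v| <= `|u| * `|v|.
Proof.
have [->|v0] := eqVneq v 0; first by rewrite linear0r normr0 mulr_ge0.
have vv0 : dot v v != 0 by rewrite dnorm_eq0.
pose a := dot u v / dot v v; pose u1 := u - a *: v.
have ou : dot u1 v = 0 by rewrite dotBl dotZl divfK// subrr.
have uE : u = u1 + a *: v by rewrite subrK.
have : (`|a| * `|v|) ^+ 2 <= `|u| ^+ 2.
  have ouv : dot u1 (a *: v) = 0 by rewrite dotZr ou mulr0.
  have h : dot (u1 + a *: v) (u1 + a *: v) = dot u1 u1 + dot (a *: v) (a *: v).
    exact: (hnormDd ouv).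
  rewrite norm_dot {1 2}uE h dotZl dotZr mulrA -normCK exprMn norm_dot lerDr.
  exact: dnorm_ge0.
rewrite ler_pXn2r// ?nnegrE ?mulr_ge0// => h.
have -> : dot u v = a * `|v| ^+ 2 by rewrite norm_dot divfK.
by rewrite normrM normrX normr_id expr2 mulrA ler_wpM2r.
Qed.

Lemma rnorm_cauchy_schwarz (u v : V) : cabs (dot u v) <= rnorm u * rnorm v.
Proof. by rewrite -lecR rmorphM /= -cabsE -!rnormE cauchy_schwarz. Qed.

Lemma cvg_normedP {T : Type} (F : set_system T) {FF : Filter F}
    (f : T -> V) x :
  f @ F --> x <-> forall e : R, 0 < e -> \forall t \near F, rnorm (f t - x) < e.
Proof.
split.
  move=> /cvgrPdist_lt h e e0; have := h e%:C; rewrite ltcR => /(_ e0).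
  by apply: filterS => t; rewrite distrC rnormE ltcR.
move=> h; apply/cvgrPdist_lt => e /complex_gt0E[r r0 ->].
by apply: filterS (h r r0) => t; rewrite distrC rnormE ltcR.
Qed.

Lemma cvg_dot {T : Type} (F : set_system T) {FF : Filter F} (f g : T -> V) x y :
  f @ F --> x -> g @ F --> y -> (fun t => dot (f t) (g t)) @ F --> dot x y.
Proof.
move=> /cvg_normedP hf /cvg_normedP hg; apply/cvg_complexP => e e0.
pose s := rnorm x + rnorm y + 2.
have s0 : 0 < s by have := rnorm_ge0 x; have := rnorm_ge0 y; rewrite /s; lra.
pose d := Num.min 1 (e / s).
have d0 : 0 < d by rewrite lt_min ltr01 divr_gt0.
apply: filterS2 (hf d d0) (hg d d0) => t ft gt.
have -> : dot (f t) (g t) - dot x y = dot (f t - x) (g t) + dot x (g t - y).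
  by rewrite dotBl dotBr; ring.
apply: (le_lt_trans (cabsD _ _)).
apply: (le_lt_trans (lerD (rnorm_cauchy_schwarz _ _) (rnorm_cauchy_schwarz _ _))).
have d1 : d <= 1 by rewrite ge_min lexx.
have ds : d * s <= e by rewrite -ler_pdivlMr// ge_min lexx orbT.
have gy : rnorm (g t) <= rnorm y + 1.
  rewrite -(subrK y (g t)) addrC; apply: (le_trans (rnormD _ _)).
  by rewrite lerD2l; apply: ltW; apply: lt_le_trans gt d1.
have h1 : rnorm (f t - x) * rnorm (g t) <= d * (rnorm y + 1).
  by apply: ler_pM => //; rewrite ?rnorm_ge0// ltW.
have h2 : rnorm x * rnorm (g t - y) <= rnorm x * d.
  by apply: ler_wpM2l; rewrite ?rnorm_ge0// ltW.
apply: (le_lt_trans (lerD h1 h2)); apply: lt_le_trans ds.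
by rewrite /s; have := d0; lra.
Qed.

End InnerProduct.

Section ConjugateCoordinates.
Context {R : realType} {m : nat}.
Local Notation C := R[i].
Local Notation Cm := 'rV[C]_m.

Lemma conjvK (z : Cm) : conjv (conjv z) = z.
Proof. by apply/rowP => j; rewrite !mxE conjCK. Qed.

Lemma conjvD (z w : Cm) : conjv (z + w) = conjv z + conjv w.
Proof. by apply/rowP => j; rewrite !mxE rmorphD. Qed.

Lemma conjvB (z w : Cm) : conjv (z - w) = conjv z - conjv w.
Proof. by apply/rowP => j; rewrite !mxE rmorphB. Qed.

Lemma conjvZ (k : C) (z : Cm) : conjv (k *: z) = Num.conj k *: conjv z.
Proof. by apply/rowP => j; rewrite !mxE rmorphM. Qed.

Lemma cabs_conj (k : C) : cabs (Num.conj k) = cabs k.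
Proof. by apply: complexI; rewrite -!cabsE norm_conjC. Qed.

Lemma norm_conjv (z : Cm) : `|conjv z| = `|z|.
Proof.
have normE (x : Cm) : `|x| = mx_norm x by [].
rewrite !normE !mx_normE; congr (_%:num); apply: eq_bigr => i _.
by apply: val_inj => /=; rewrite mxE norm_conjC.
Qed.

Lemma conjv_continuous : continuous (@conjv R m).
Proof.
move=> z A /near_normedP[r r0 h].
have : \forall w \near z, A (conjv w).
  apply/near_normedP; exists r => // w wr.
  by apply: h; rewrite -conjvB /rnorm norm_conjv.
exact: id.
Qed.

Lemma of_real_coords_continuous : continuous (@of_real_coords R m).
Proof.
move=> [p1 p2]; apply/cvg_ballP => e e0.
have H (j : 'I_m) : \forall q \near (p1, p2),
    ball (of_real_coords (p1, p2) 0 j) e (of_real_coords q 0 j).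
  have [r r0 er] := complex_gt0E e0.
  have h1 : (fun q : 'rV[R]_m * 'rV[R]_m => q.1 0 j) @ (p1, p2) --> p1 0 j.
    have c1 : (fst : 'rV[R]_m * 'rV[R]_m -> 'rV[R]_m) @ (p1, p2) --> p1 by exact: cvg_fst.
    have c2 : (fun q : 'rV[R]_m => q 0 j) @ p1 --> p1 0 j by exact: coord_continuous.
    exact: (cvg_comp _ _ c1 c2).
  have h2 : (fun q : 'rV[R]_m * 'rV[R]_m => q.2 0 j) @ (p1, p2) --> p2 0 j.
    have c1 : (snd : 'rV[R]_m * 'rV[R]_m -> 'rV[R]_m) @ (p1, p2) --> p2 by exact: cvg_snd.
    have c2 : (fun q : 'rV[R]_m => q 0 j) @ p2 --> p2 0 j by exact: coord_continuous.
    exact: (cvg_comp _ _ c1 c2).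
  have r20 : 0 < r / 2 by rewrite divr_gt0.
  move: h1 h2 => /cvgrPdist_lt /(_ _ r20) h1 /cvgrPdist_lt /(_ _ r20) h2.
  apply: filterS2 h1 h2 => q q1 q2.
  rewrite -ball_normE /ball_ /= !mxE er cabsE ltcR.
  apply: (le_lt_trans (cabs_le_ReIm _)) => /=.
  by rewrite (splitr r) ltrD.
have := @filter_forall _ _ _ _ (nbhs_filter (p1, p2)) H.
apply: filterS => q hq; split=> // i j; rewrite (ord1 i); exact: hq.
Qed.

Lemma of_real_coordsP (t : R) (p q : 'rV[R]_m * 'rV[R]_m) :
  of_real_coords (t *: q + p) = t%:C *: of_real_coords q + of_real_coords p.
Proof.
case: p q => p1 p2 [q1 q2].
have -> : t *: (q1, q2) + (p1, p2) = (t *: q1 + p1, t *: q2 + p2) by [].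
by apply/rowP => j; rewrite !mxE; apply: complex_eq => /=; ring.
Qed.

End ConjugateCoordinates.

Section PolarisedGram.
Context {R : realType} {V : completeNormedModType R[i]} {m d : nat}.
Context (dot : {dot V for @Num.conj R[i]}).
Context (norm_dot : forall f : V, `|f| ^+ 2 = dot f f).
Local Notation C := R[i].
Local Notation Cm := 'rV[C]_m.
Context (U : set Cm) (oU : open U) (Kd : 'I_d -> Cm -> V).
Context (hKd : forall i, antiholomorphic U (Kd i)).

Definition polarised_domain : set (Cm * Cm) :=
  [set x | U (conjv x.1) /\ U x.2].

(** The Gram matrix of the [Kd ^~ w] is the value at (conj w, w); separating the
    two arguments makes the entries holomorphic in both. *)
Definition polarised_gram (x : Cm * Cm) : 'M[C]_d :=
  \matrix_(i, j) dot (Kd i (conjv x.1)) (Kd j x.2).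

Lemma open_polarised_domain : open polarised_domain.
Proof.
rewrite (_ : polarised_domain = (fst @^-1` (@conjv R m @^-1` U)) `&` (snd @^-1` U))//.
have oc : open (@conjv R m @^-1` U).
  by apply: open_comp => // z _; exact: conjv_continuous.
apply: openI; apply: open_comp => // x _; [exact: cvg_fst|exact: cvg_snd].
Qed.

Let near0_conj : Num.conj @ (0 : C)^' --> (0 : C)^'.
Proof.
move=> A; rewrite /= !nbhs_simpl /= => /near_complexP[r r0 h].
apply/near_complexP; exists r => // k; rewrite subr0 => kr k0; apply: h.
  by rewrite subr0 cabs_conj.
by rewrite conjC_eq0.
Qed.

Let line_cvg (W : normedModType C) (z a : W) :
  (fun k : C => k *: a + z) @ (0 : C)^' --> z.
Proof.
move=> A /near_normedP[r r0 h].
have a1 : 0 < rnorm a + 1 by rewrite ltr_wpDl ?rnorm_ge0.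
have : \forall k \near (0 : C)^', A (k *: a + z).
  rewrite near_withinE; apply/near_complexP; exists (r / (rnorm a + 1)).
    by rewrite divr_gt0.
  move=> k; rewrite subr0 ltr_pdivlMr// => kr _; apply: h.
  rewrite addrK rnormZ; apply: le_lt_trans kr.
  by rewrite ler_wpM2l ?cabs_ge0// lerDl.
exact: id.
Qed.

(** In the second variable two conjugations cancel, that of the antiholomorphic
    [Kd j] and that of the second argument of the inner product: the increment
    k in the direction b is seen by [Kd j \o conjv] as the increment conj k in
    the direction conj b. *)
Lemma gateaux_holo_polarised_gram i j :
  gateaux_holo polarised_domain (fun x => polarised_gram x i j).
Proof.
rewrite (_ : (fun x => _) = (fun x => dot (Kd i (conjv x.1)) (Kd j x.2))); last first.
  by apply/funext => x; rewrite mxE.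
move=> [z v] [/= Uz Uv].
have dz : differentiable (Kd i \o @conjv R m) z.
  by have := hKd i Uz; rewrite conjvK.
have dv : differentiable (Kd j \o @conjv R m) (conjv v) := hKd j Uv.
have cz : {for z, continuous (Kd i \o @conjv R m)} := differentiable_continuous dz.
have cv : Kd j @ v --> Kd j v.
  have E : (Kd j \o @conjv R m) \o @conjv R m = Kd j.
    by apply/funext => w /=; rewrite conjvK.
  have h : ((Kd j \o @conjv R m) \o @conjv R m) @ v --> (Kd j \o @conjv R m) (conjv v).
    exact: (cvg_comp _ _ (@conjv_continuous R m v) (differentiable_continuous dv)).
  by move: h; rewrite E /= conjvK.
split.
  have f1 : (fst : Cm * Cm -> Cm) @ (z, v) --> z by exact: cvg_fst.
  have f2 : (snd : Cm * Cm -> Cm) @ (z, v) --> v by exact: cvg_snd.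
  have c1 : (fun x : Cm * Cm => Kd i (conjv x.1)) @ (z, v) --> Kd i (conjv z).
    exact: (cvg_comp _ _ f1 cz).
  have c2 : (fun x : Cm * Cm => Kd j x.2) @ (z, v) --> Kd j v.
    exact: (cvg_comp _ _ f2 cv).
  exact: (cvg_dot norm_dot c1 c2).
move=> [a b].
set ki := Kd i \o @conjv R m in dz cz *.
set kj := Kd j \o @conjv R m in dv *.
have lim1 : (fun k : C => k^-1 *: (ki (k *: a + z) - ki z)) @ (0 : C)^' --> 'D_a ki z.
  exact: (@diff_derivable _ _ _ ki z a dz).
have lim2 : (fun k : C => k^-1 *: (kj (k *: conjv b + conjv v) - kj (conjv v)))
    @ (0 : C)^' --> 'D_(conjv b) kj (conjv v).
  exact: (@diff_derivable _ _ _ kj (conjv v) (conjv b) dv).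
have lim3 : (fun k : C => (Num.conj k)^-1 *:
    (kj (Num.conj k *: conjv b + conjv v) - kj (conjv v))) @ (0 : C)^'
    --> 'D_(conjv b) kj (conjv v) := cvg_comp _ _ near0_conj lim2.
have lim4 : (fun k : C => Kd j (k *: b + v)) @ (0 : C)^' --> Kd j v.
  exact: (cvg_comp _ _ (@line_cvg _ v b) cv).
have lim5 := @cvg_dot _ _ _ norm_dot _ _ (dnbhs_filter (0 : C)) _ _ _ _ lim1 lim4.
have lim6 := @cvg_dot _ _ _ norm_dot _ _ (dnbhs_filter (0 : C)) _ _ _ _
  (@cvg_cst _ (ki z) C (0 : C)^' (dnbhs_filter (0 : C))) lim3.
have lim7 := @cvgD _ _ _ _ (dnbhs_filter (0 : C)) _ _ _ _ lim5 lim6.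
apply: (@derivable_lim _ _ _ _ _ _ _).1.
apply: (cvg_trans _ lim7); apply: near_eq_cvg.
rewrite near_withinE; apply: nearW => k k0.
have E : dot (k^-1 *: (ki (k *: a + z) - ki z)) (Kd j (k *: b + v)) +
  dot (ki z) ((Num.conj k)^-1 *: (kj (Num.conj k *: conjv b + conjv v) - kj (conjv v)))
  = k^-1 * (dot (Kd i (conjv (k *: a + z))) (Kd j (k *: b + v))
            - dot (Kd i (conjv z)) (Kd j v)).
  rewrite /ki /kj /= !(conjvD, conjvZ, conjvK, conjCK) !dotZl !dotZr fmorphV /= conjCK.
  by rewrite dotBl dotBr; field.
exact: E.
Qed.

End PolarisedGram.

(** * Gram matrices and smoothness of their inverses *)

Section GramMatrices.
Context {R : realType} {V : completeNormedModType R[i]}.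
Context (dot : {dot V for @Num.conj R[i]}).
Local Notation C := R[i].
Local Notation adj A := (map_mx (@Num.conj C) A^T).

Lemma adjK p q (A : 'M[C]_(p, q)) : adj (adj A) = A.
Proof. by apply/matrixP => i j; rewrite !mxE conjCK. Qed.

Lemma adjM p q r (A : 'M[C]_(p, q)) (B : 'M[C]_(q, r)) :
  adj (A *m B) = adj B *m adj A.
Proof. by rewrite trmx_mul map_mxM. Qed.

Lemma adj_inv n (A : 'M[C]_n) : adj (invmx A) = invmx (adj A).
Proof. by rewrite trmx_inv map_invmx. Qed.

Lemma form_conj n (P : 'M[C]_n) (a b : 'rV[C]_n) : adj P = P ->
  form Num.conj P b a = Num.conj (form Num.conj P a b).
Proof.
move=> hP; rewrite /form.
have -> : Num.conj ((a *m P *m adj b) 0 0) = (adj (a *m P *m adj b)) 0 0.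
  by rewrite !mxE.
by rewrite !adjM adjK hP mulmxA.
Qed.

Section Gram.
Context {n : nat} (v : 'I_n -> V).

Lemma gram_adj : adj (gram dot v) = gram dot v.
Proof. by apply/matrixP => i j; rewrite !mxE -dotC. Qed.

Lemma form_gram (a b : 'rV[C]_n) : form Num.conj (gram dot v) a b =
  dot (\sum_i a 0 i *: v i) (\sum_j b 0 j *: v j).
Proof.
rewrite dot_sumr /form mxE; apply: eq_bigr => j _.
rewrite mxE mxE dotZr dot_suml mulrC mxE; congr (_ * _).
by apply: eq_bigr => i _; rewrite dotZl mxE.
Qed.

Lemma posdef_gram : lin_indep v -> posdef (gram dot v).
Proof.
move=> free_v; split=> [a b|a a0]; first exact: (form_conj _ _ gram_adj).
rewrite form_gram dnorm_gt0; apply: contra a0 => /eqP /free_v a0.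
by apply/eqP/rowP => i; rewrite mxE a0.
Qed.

Lemma posdef_unitmx (P : 'M[C]_n) : posdef P -> P \in unitmx.
Proof.
move=> [_ pos]; rewrite -row_free_unit -kermx_eq0; apply/eqP/row_matrixP => i.
rewrite row0; apply/eqP; apply: contraT => /pos; rewrite /form -row_mul mulmx_ker.
by rewrite row0 mul0mx mxE ltxx.
Qed.

Lemma posdef_adj (P : 'M[C]_n) : posdef P -> adj P = P.
Proof.
move=> [h _]; apply/matrixP => i j.
have E k l : form Num.conj P (delta_mx 0 k) (delta_mx 0 l) = P k l.
  exact: formee.
by rewrite !mxE -!E -h.
Qed.

Lemma posdef_invmx (P : 'M[C]_n) : posdef P -> posdef (invmx P).
Proof.
move=> hP; have uP := posdef_unitmx hP; have aP := posdef_adj hP.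
have aI : adj (invmx P) = invmx P by rewrite adj_inv aP.
split=> [a b|a a0]; first exact: form_conj.
have b0 : a *m invmx P != 0.
  by apply: contra a0 => /eqP h; rewrite -(mulmxKV uP a) h mul0mx.
have := hP.2 _ b0; rewrite /form adjM aI.
by rewrite mulmxKV// mulmxA.
Qed.

End Gram.
End GramMatrices.

Section SmoothInverseGram.
Context {R : realType} {V : completeNormedModType R[i]} {m d : nat}.
Context (dot : {dot V for @Num.conj R[i]}).
Context (norm_dot : forall f : V, `|f| ^+ 2 = dot f f).
Local Notation C := R[i].
Local Notation Cm := 'rV[C]_m.

Lemma open_of_real_coords (U : set Cm) : open U -> open (of_real_coords @^-1` U).
Proof.
by move=> oU; apply: open_comp => // p _; exact: of_real_coords_continuous.
Qed.

Lemma open_gateaux_holo_neq0 (W : normedModType C) (U : set W) (F : W -> C) : open U ->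
  gateaux_holo U F -> open [set x | U x /\ F x != 0].
Proof.
move=> oU FU; rewrite openE => x [Ux Fx]; rewrite /interior /=.
apply: filterI; first exact: (open_nbhs_nbhs (conj oU Ux)).
have [cF _] := FU x Ux.
have Fx0 : 0 < cabs (F x) by rewrite cabs_gt0.
have := ((@cvg_complexP _ _ _ (nbhs_filter x) F _).1 cF) _ Fx0.
apply: filterS => y; apply: contraTN => /eqP ->.
by rewrite sub0r cabsN ltxx.
Qed.

(** The inverse of the polarised Gram matrix is holomorphic where its determinant
    is nonzero, an open set containing the points (conj w, w) with w in [U]. *)
Theorem smooth_invmx_gram (U : set Cm) (Kd : 'I_d -> Cm -> V) : open U ->
  (forall i, antiholomorphic U (Kd i)) ->
  (forall u, U u -> lin_indep (Kd ^~ u)) ->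
  forall i j, smooth U (fun w => invmx (gram dot (Kd ^~ w)) i j).
Proof.
move=> oU hKd free i j.
pose G := polarised_gram dot Kd.
have gG := gateaux_holo_polarised_gram norm_dot hKd.
have gdet : gateaux_holo (polarised_domain U) (fun x => \det (G x)) := gateaux_holo_det gG.
pose D := [set x | polarised_domain U x /\ \det (G x) != 0].
have oD : open D := open_gateaux_holo_neq0 (open_polarised_domain oU) gdet.
have gGD k l : gateaux_holo D (fun x => G x k l) by move=> x [Ux _]; exact: gG.
have uG x : D x -> G x \in unitmx by move=> [_]; rewrite unitmxE unitfE.
have gI := gateaux_holo_invmx oD uG gGD i j.
pose L (p : 'rV[R]_m * 'rV[R]_m) := (conjv (of_real_coords p), of_real_coords p).
have GL p : G (L p) = gram dot (Kd ^~ (of_real_coords p)).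
  by apply/matrixP => k l; rewrite !mxE /= conjvK.
have LP (t : R) p q : L (t *: q + p) = t%:C *: L q + L p.
  rewrite /L of_real_coordsP conjvD conjvZ.
  have -> : Num.conj t%:C = t%:C by apply: complex_eq; rewrite /= ?oppr0.
  by [].
have cL : continuous L.
  move=> p.
  have c2 : of_real_coords q @[q --> p] --> of_real_coords p.
    exact: of_real_coords_continuous.
  have c1 : conjv (of_real_coords q) @[q --> p] --> conjv (of_real_coords p).
    exact: (cvg_comp _ _ c2 (@conjv_continuous R m _)).
  have := cvg_pair c1 c2; exact.
have oA := open_of_real_coords oU.
have AD p : (of_real_coords @^-1` U) p -> D (L p).
  move=> Up; split; first by split; rewrite /= ?conjvK.
  rewrite GL -unitfE -unitmxE; apply: posdef_unitmx; apply: posdef_gram.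
  exact: free.
have E P : (fun p => P (invmx (gram dot (Kd ^~ (of_real_coords p))) i j)) =
   (fun p => P (invmx (G (L p)) i j)) :> ('rV[R]_m * 'rV[R]_m -> R).
  by apply/funext => p; rewrite GL.
move=> k; split.
- rewrite (E (@complex.Re R)).
  apply: (Ck_restriction (@ReB R) _ (@Re_le_cabs R) LP cL oD oA AD k gI).
  by move=> r a; rewrite ReM /= mul0r subr0.
- rewrite (E (@complex.Im R)).
  apply: (Ck_restriction (@ImB R) _ (@Im_le_cabs R) LP cL oD oA AD k gI).
  by move=> r a; rewrite ImM /= mul0r addr0.
Qed.

End SmoothInverseGram.

(** * Germs and minimal generators *)

Section DifferentiableIntro.
Context {R : realType} {W1 W2 : normedModType R[i]}.
Local Notation C := R[i].

Lemma differentiable_intro (f : W1 -> W2) (df : {linear W1 -> W2}) z :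
  continuous df ->
  (forall e : R, 0 < e -> \forall h \near (0 : W1),
     rnorm (f (h + z) - f z - df h) <= e * rnorm h) ->
  differentiable f z.
Proof.
move=> cdf H.
have E : f \o shift z = cst (f z) + df +o_ 0 id.
  apply/eqaddoP => e /complex_gt0E[r r0 ->].
  apply: filterS (H r r0) => h.
  rewrite -lecR rmorphM /= -!rnormE.
  have -> : f (h + z) - f z - df h = (f \o shift z - (cst (f z) + df)) h.
    by rewrite -addrA -opprD.
  by [].
have D := diff_unique cdf E.
by apply/diff_locallyP; rewrite D.
Qed.

Lemma differentiable_bound (f : W1 -> W2) z : differentiable f z ->
  forall e : R, 0 < e -> \forall h \near (0 : W1),
    rnorm (f (h + z) - f z - 'd f z h) <= e * rnorm h.
Proof.
move=> /diff_locallyP[_ /eqaddoP H] e e0.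
have := H e%:C; rewrite ltcR => /(_ e0); apply: filterS => h.
rewrite -lecR rmorphM /= -!rnormE.
have -> : f (h + z) - f z - 'd f z h = (f \o shift z - (cst (f z) + 'd f z)) h.
  by rewrite -addrA -opprD.
by [].
Qed.

End DifferentiableIntro.

Section DotAntiholomorphic.
Context {R : realType} {V : completeNormedModType R[i]} {m : nat}.
Context (dot : {dot V for @Num.conj R[i]}).
Context (norm_dot : forall f : V, `|f| ^+ 2 = dot f f).
Local Notation C := R[i].
Local Notation Cm := 'rV[C]_m.

(** The differential of u |-> dot f (k u), when [A] is that of [k \o conjv]. *)
Definition dot_conj (f : V) (A : {linear Cm -> V}) (h : Cm) : C :=
  dot f (A (conjv h)).

Lemma dot_conj_is_linear f A : linear (dot_conj f A).
Proof.
move=> k h1 h2; rewrite /dot_conj conjvD conjvZ linearP.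
by rewrite dotDr dotZr conjCK.
Qed.

HB.instance Definition _ f A := GRing.isLinear.Build C Cm C _ (dot_conj f A)
  (dot_conj_is_linear f A).

Lemma rnorm_conjv (z : Cm) : rnorm (conjv z) = rnorm z.
Proof. by rewrite /rnorm norm_conjv. Qed.

Lemma dot_antiholomorphic (f : V) (k : Cm -> V) (u : Cm) :
  differentiable (k \o @conjv R m) (conjv u) ->
  differentiable (fun u => dot f (k u)) u.
Proof.
move=> dk; have cdk := diff_continuous dk.
set A := 'd (k \o @conjv R m) (conjv u) in cdk *.
apply: (@differentiable_intro _ _ _ _ (dot_conj f A)).
  move=> h.
  have c1 : (fun h => A (conjv h)) @ h --> A (conjv h).
    exact: (cvg_comp _ _ (@conjv_continuous R m h) (cdk (conjv h))).
  exact: (@cvg_dot _ _ _ norm_dot _ _ (nbhs_filter h) _ _ _ _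
    (@cvg_cst _ f _ _ (nbhs_filter h)) c1).
move=> e e0; pose e' := e / (rnorm f + 1).
have f1 : 0 < rnorm f + 1 by rewrite ltr_wpDl ?rnorm_ge0.
have e'0 : 0 < e' by rewrite divr_gt0.
have /near_normedP[r r0 H] := differentiable_bound dk e'0.
apply/near_normedP; exists r => // h; rewrite subr0 => hr.
have := H (conjv h); rewrite subr0 rnorm_conjv => /(_ hr).
rewrite /= conjvD !conjvK -/A => {}H.
have -> : dot f (k (h + u)) - dot f (k u) - dot_conj f A h =
    dot f (k (h + u) - k u - A (conjv h)).
  by rewrite !dotBr.
apply: (le_trans (rnorm_cauchy_schwarz norm_dot _ _)).
apply: (@le_trans _ _ (rnorm f * (e' * rnorm h))).
  by rewrite ler_wpM2l// rnorm_ge0.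
rewrite mulrA ler_wpM2r ?rnorm_ge0// /e' mulrA ler_pdivrMr// mulrC.
by rewrite ler_wpM2l ?lerDl// ltW.
Qed.

End DotAntiholomorphic.

Section Germs.
Context {R : realType} {m : nat}.
Local Notation C := R[i].
Local Notation Cm := 'rV[C]_m.
Local Notation fn := (Cm -> C).
Implicit Types (w u : Cm) (f g : fn).

Lemma near_mono w (P Q : Cm -> Prop) : (forall u, P u -> Q u) ->
  (\forall u \near w, P u) -> \forall u \near w, Q u.
Proof. exact: (@filterS _ _ (nbhs_filter w)). Qed.

Lemma near_mono2 w (P Q T : Cm -> Prop) : (forall u, P u -> Q u -> T u) ->
  (\forall u \near w, P u) -> (\forall u \near w, Q u) -> \forall u \near w, T u.
Proof. exact: (@filterS2 _ _ (nbhs_filter w)). Qed.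

Lemma near_all w (P : Cm -> Prop) : (forall u, P u) -> \forall u \near w, P u.
Proof.
move=> H; apply: (@filterS _ _ (nbhs_filter w) setT) => [u _|].
  exact: H.
exact: filterT.
Qed.

Lemma near_forall w (I : finType) (P : I -> Cm -> Prop) :
  (forall i, \forall u \near w, P i u) -> \forall u \near w, forall i, P i u.
Proof. exact: (@filter_forall _ _ _ _ (nbhs_filter w)). Qed.

Lemma holo_near_cst w (c : C) : holomorphic_near w (fun=> c).
Proof. by apply: near_all => u; exact: differentiable_cst. Qed.

Lemma holo_nearD w f g : holomorphic_near w f -> holomorphic_near w g ->
  holomorphic_near w (fun u => f u + g u).
Proof. by apply: near_mono2 => u df dg; exact: (differentiableD df dg). Qed.

Lemma holo_nearB w f g : holomorphic_near w f -> holomorphic_near w g ->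
  holomorphic_near w (fun u => f u - g u).
Proof. by apply: near_mono2 => u df dg; exact: (differentiableB df dg). Qed.

Lemma holo_nearM w f g : holomorphic_near w f -> holomorphic_near w g ->
  holomorphic_near w (fun u => f u * g u).
Proof. by apply: near_mono2 => u df dg; exact: (differentiableM df dg). Qed.

Lemma holo_near_sum w (I : Type) (r : seq I) (P : pred I) (f : I -> fn) :
  (forall i, P i -> holomorphic_near w (f i)) ->
  holomorphic_near w (fun u => \sum_(i <- r | P i) f i u).
Proof.
move=> H; elim: r => [|i r IH].
  rewrite (_ : (fun _ => _) = (fun=> 0)); first exact: holo_near_cst.
  by apply/funext => u; rewrite big_nil.
case Pi : (P i); last first.
  rewrite (_ : (fun _ => _) = (fun u => \sum_(i <- r | P i) f i u)); first exact: IH.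
  by apply/funext => u; rewrite big_cons Pi.
rewrite (_ : (fun _ => _) = (fun u => f i u + \sum_(i <- r | P i) f i u)).
  exact: (holo_nearD (H i Pi) IH).
by apply/funext => u; rewrite big_cons Pi.
Qed.

Lemma holo_near_continuous w f : holomorphic_near w f -> {for w, continuous f}.
Proof. by move=> /nbhs_singleton; exact: differentiable_continuous. Qed.

Lemma holo_near_neq0 w f : holomorphic_near w f -> f w != 0 ->
  \forall u \near w, f u != 0.
Proof.
move=> /holo_near_continuous cf f0.
have fw0 : 0 < cabs (f w) by rewrite cabs_gt0.
have := ((@cvg_complexP _ _ _ (nbhs_filter w) f _).1 cf) _ fw0.
by apply: near_mono => u; apply: contraTN => /eqP ->; rewrite sub0r cabsN ltxx.
Qed.

Lemma holo_nearV w f : holomorphic_near w f -> f w != 0 ->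
  holomorphic_near w (fun u => (f u)^-1).
Proof.
move=> hf /(holo_near_neq0 hf); apply: near_mono2 hf => u df f0.
exact: (differentiableV df f0).
Qed.

Lemma holo_near_near w f : holomorphic_near w f ->
  \forall u \near w, holomorphic_near u f.
Proof. by move=> hf; apply: nbhs_interior. Qed.

Lemma near_eq_near w (P : Cm -> Prop) : (\forall u \near w, P u) ->
  \forall u \near w, \forall v \near u, P v.
Proof. by move=> hP; apply: nbhs_interior. Qed.

Lemma germ_ideal_range w n (g : 'I_n -> fn) f : germ_ideal w (range g) f <->
  exists2 a : 'I_n -> fn, forall i, holomorphic_near w (a i) &
    \forall u \near w, f u = \sum_i a i u * g i u.
Proof.
split=> [[p [a [g' [ha hg' fE]]]]|[a ha fE]]; last first.
  by exists n, a, g; split=> // i; exists i.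
have /choice[k hk] l : exists i, g i = g' l by have [i _ <-] := hg' l; exists i.
exists (fun i u => \sum_(l | k l == i) a l u).
  by move=> i; apply: holo_near_sum => l _; exact: ha.
apply: near_mono fE => u ->.
rewrite (partition_big k xpredT)//=; apply: eq_bigr => i _.
by rewrite mulr_suml; apply: eq_bigr => l /eqP <-; rewrite hk.
Qed.

Lemma germ_ideal_gen w n (g : 'I_n -> fn) i : germ_ideal w (range g) (g i).
Proof.
apply/germ_ideal_range; exists (fun j _ => (j == i)%:R).
  by move=> j; exact: holo_near_cst.
apply: near_all => u; rewrite (bigD1 i)//= eqxx mul1r big1 ?addr0// => j ji.
by rewrite (negPf ji) mul0r.
Qed.

(** Substituting an expression of the [g i] by the [t j] into a combination of
    the [g i]. *)
Lemma germ_combination w n p (g : 'I_n -> fn) (t : 'I_p -> fn) (a : 'I_n -> fn)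
    (c : 'I_n -> 'I_p -> fn) f :
  (forall i, holomorphic_near w (a i)) ->
  (forall i j, holomorphic_near w (c i j)) ->
  (\forall u \near w, forall i, g i u = \sum_j c i j u * t j u) ->
  (\forall u \near w, f u = \sum_i a i u * g i u) ->
  (forall j, holomorphic_near w (fun u => \sum_i a i u * c i j u)) /\
  \forall u \near w, f u = \sum_j (\sum_i a i u * c i j u) * t j u.
Proof.
move=> ha hc gE fE; split.
  by move=> j; apply: holo_near_sum => i _; exact: (holo_nearM (ha i) (hc i j)).
apply: near_mono2 gE fE => u gE ->.
under eq_bigr do rewrite gE mulr_sumr.
rewrite exchange_big /=; apply: eq_bigr => j _.
by rewrite mulr_suml; apply: eq_bigr => i _; rewrite mulrA.
Qed.

Lemma germ_ideal_coefs w n p (g : 'I_n -> fn) (t : 'I_p -> fn) :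
  (forall i, germ_ideal w (range t) (g i)) ->
  exists2 c : 'I_n -> 'I_p -> fn, forall i j, holomorphic_near w (c i j) &
    \forall u \near w, forall i, g i u = \sum_j c i j u * t j u.
Proof.
move=> H.
have /choice[c hc] i : exists c : 'I_p -> fn, (forall j, holomorphic_near w (c j)) /\
    \forall u \near w, g i u = \sum_j c j u * t j u.
  by have /germ_ideal_range[c h1 h2] := H i; exists c.
exists c => [i|]; first exact: (hc i).1.
by apply: near_forall => i; exact: (hc i).2.
Qed.

Lemma germ_ideal_range_sub w n p (g : 'I_n -> fn) (t : 'I_p -> fn)
    (c : 'I_n -> 'I_p -> fn) : (forall i j, holomorphic_near w (c i j)) ->
  (\forall u \near w, forall i, g i u = \sum_j c i j u * t j u) ->
  germ_ideal w (range g) `<=` germ_ideal w (range t).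
Proof.
move=> hc gE f /germ_ideal_range[a ha fE]; apply/germ_ideal_range.
have [h1 h2] := germ_combination ha hc gE fE.
by exists (fun j u => \sum_i a i u * c i j u).
Qed.

(** The finitely many germs that express the two families by each other at [w]
    are defined, and the identities hold, on a common neighbourhood. *)
Lemma generators_near S w n (g : 'I_n -> fn) p (t : 'I_p -> fn) :
  generators S w g -> (\forall u \near w, generators S u t) ->
  \forall u \near w, generators S u g.
Proof.
move=> Sg St; have Stw : generators S w t := nbhs_singleton St.
have [b hb tE] : exists2 b : 'I_p -> 'I_n -> fn,
    forall i j, holomorphic_near w (b i j) &
    \forall u \near w, forall i, t i u = \sum_j b i j u * g j u.
  by apply: germ_ideal_coefs => i; rewrite -Sg Stw; exact: germ_ideal_gen.
have [c hc gE] : exists2 c : 'I_n -> 'I_p -> fn,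
    forall i j, holomorphic_near w (c i j) &
    \forall u \near w, forall i, g i u = \sum_j c i j u * t j u.
  by apply: germ_ideal_coefs => i; rewrite -Stw Sg; exact: germ_ideal_gen.
have hb' : \forall u \near w, forall i j, holomorphic_near u (b i j).
  by apply: near_forall => i; apply: near_forall => j; exact: holo_near_near.
have hc' : \forall u \near w, forall i j, holomorphic_near u (c i j).
  by apply: near_forall => i; apply: near_forall => j; exact: holo_near_near.
have tE' := near_eq_near tE; have gE' := near_eq_near gE.
near=> u.
have Su : generators S u t by near: u.
rewrite /generators Su; apply/seteqP; split.
- by apply: (@germ_ideal_range_sub _ _ _ _ _ b); near: u.
- by apply: (@germ_ideal_range_sub _ _ _ _ _ c); near: u.
Unshelve. all: by end_near. Qed.

(** A coefficient that does not vanish at [w] is a unit of the local ring, so the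
    corresponding generator would be a combination of the others. *)
Lemma minimal_generators_relation S w e (s : 'I_e -> fn) (a : 'I_e -> fn) :
  minimal_generators S w s -> (forall i, holomorphic_near w (a i)) ->
  (\forall u \near w, \sum_i a i u * s i u = 0) -> forall i, a i w = 0.
Proof.
case: e s a => [|e] s a [Ss min] ha rel j; first by case: j.
apply/eqP; apply: contraT => aj.
have DT : ([set~ j] `<` [set: 'I_e.+1])%classic.
  by split=> // h; have := h j I; apply.
exfalso; apply: (min _ DT); rewrite Ss; apply/seteqP; split; last first.
  move=> f [p [b [g [hb hg fE]]]]; exists p, b, g; split=> // i.
  by have [k _ <-] := hg i; exists k.
move=> f /germ_ideal_range[b hb fE].
exists e, (fun l u => b (lift j l) u - b j u * a (lift j l) u * (a j u)^-1),
  (fun l => s (lift j l)); split.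
- move=> l; apply: holo_nearB; first exact: hb.
  by apply: holo_nearM; [exact: (holo_nearM (hb j) (ha _))|exact: holo_nearV].
- by move=> l; exists (lift j l) => //=; apply/eqP; rewrite eq_sym neq_lift.
near=> u.
have aju : a j u != 0 by near: u; exact: (holo_near_neq0 (ha j) aj).
have relu : \sum_i a i u * s i u = 0 by near: u.
have -> : f u = \sum_i b i u * s i u by near: u.
rewrite (bigD1_ord j)//= in relu; rewrite (bigD1_ord j)//=.
have -> : s j u = - (a j u)^-1 * \sum_(l < e) a (lift j l) u * s (lift j l) u.
  move/eqP: relu; rewrite addr_eq0 => /eqP relu.
  by rewrite mulNr -mulrN -relu mulKf.
rewrite mulr_sumr mulr_sumr -big_split /=; apply: eq_bigr => l _; ring.
Unshelve. all: by end_near. Qed.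

Lemma minimal_generators_coefs S w e (s : 'I_e -> fn) f :
  minimal_generators S w s -> S w f ->
  exists2 a : 'I_e -> fn, forall i, holomorphic_near w (a i) &
    \forall u \near w, f u = \sum_i a i u * s i u.
Proof. by move=> [-> _] /germ_ideal_range. Qed.

(** Two expressions of the same germ differ by a relation, so their coefficients
    agree at [w]: the coordinates on the fibre are well defined. *)
Lemma max_ideal_mul_coefs S w e (s : 'I_e -> fn) (a : 'I_e -> fn) f :
  minimal_generators S w s -> (forall i, holomorphic_near w (a i)) ->
  (\forall u \near w, f u = \sum_i a i u * s i u) ->
  max_ideal_mul w (S w) f <-> forall i, a i w = 0.
Proof.
move=> Ss ha fE; split; last first.
  move=> a0; exists e, a, s; split=> // i.
  by rewrite Ss.1; exact: germ_ideal_gen.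
move=> [p [b [g [hb hg fE']]]].
have hgr i : germ_ideal w (range s) (g i) by rewrite -Ss.1.
have [c hc gE] := germ_ideal_coefs hgr.
have hb1 i : holomorphic_near w (b i) := (hb i).1.
have [h1 h2] := germ_combination hb1 hc gE fE'.
have rel i : a i w - \sum_l b l w * c l i w = 0.
  apply: (@minimal_generators_relation S w e s
    (fun i u => a i u - \sum_l b l u * c l i u) Ss).
    by move=> k; exact: (holo_nearB (ha k) (h1 k)).
  apply: near_mono2 fE h2 => u f1 f2.
  under eq_bigr do rewrite mulrBl.
  by rewrite sumrB -f1 -f2 subrr.
move=> i; move/eqP: (rel i); rewrite subr_eq0 => /eqP ->.
by rewrite big1// => l _; rewrite (hb l).2 mul0r.
Qed.

End Germs.

(** * Change of generators and the quotient inner product *)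

Section KernelDecompositions.
Context {R : realType} {m : nat}.
Context {V : completeNormedModType R[i]} (dot : {dot V for @Num.conj R[i]}).
Context (norm_dot : forall f : V, `|f| ^+ 2 = dot f f).
Local Notation C := R[i].
Local Notation Cm := 'rV[C]_m.
Local Notation fn := (Cm -> C).
Local Notation adj A := (map_mx (@Num.conj C) A^T).
Implicit Types (w : Cm) (S : Cm -> set fn).

(** Both sides are the values at [w] of decompositions of [K] along [s]. Pairing
    their difference D with the vector f := D j w gives a holomorphic relation
    between the [s l], whose j-th coefficient at [w] is dot (D j w) (D j w). *)
Lemma decomposition_change S w e d (s : 'I_e -> fn) (g : 'I_d -> fn)
    (Ks : 'I_e -> Cm -> V) (Kg : 'I_d -> Cm -> V) (K : Cm -> V)
    (U1 U2 : set Cm) (G : Cm -> 'M[C]_(e, d)) :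
  minimal_generators S w s -> open_nbhs w U1 -> open_nbhs w U2 ->
  (forall i, antiholomorphic U1 (Ks i)) -> (forall i, antiholomorphic U2 (Kg i)) ->
  (forall u, U1 u -> K u = \sum_i Num.conj (s i u) *: Ks i u) ->
  (forall u, U2 u -> K u = \sum_i Num.conj (g i u) *: Kg i u) ->
  (forall j i, holomorphic_near w (fun u => G u j i)) ->
  (\forall u \near w, (\row_j s j u) *m G u = \row_i g i u) ->
  forall j, Ks j w = \sum_i Num.conj (G w j i) *: Kg i w.
Proof.
move=> Ss /open_nbhs_nbhs U1w /open_nbhs_nbhs U2w aKs aKg KEs KEg hG sG j.
pose D l u := \sum_i Num.conj (G u l i) *: Kg i u - Ks l u.
have hdot n (U : set Cm) (k : 'I_n -> Cm -> V) f i : nbhs w U ->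
    (forall i, antiholomorphic U (k i)) ->
    holomorphic_near w (fun u => dot f (k i u)).
  by move=> Uw hk; apply: near_mono Uw => u Uu;
    exact: (dot_antiholomorphic norm_dot f (hk i u Uu)).
pose f := D j w.
pose a l u := \sum_i G u l i * dot f (Kg i u) - dot f (Ks l u).
have aE l u : a l u = dot f (D l u).
  rewrite /a /D dotBr dot_sumr; congr (_ - _).
  by apply: eq_bigr => i _; rewrite dotZr conjCK.
have ha l : holomorphic_near w (a l).
  apply: holo_nearB; last exact: (hdot _ _ _ _ _ U1w aKs).
  apply: holo_near_sum => i _.
  exact: (holo_nearM (hG l i) (hdot _ _ _ f i U2w aKg)).
have rel : \forall u \near w, \sum_l a l u * s l u = 0.
  have UU : \forall u \near w, U1 u /\ U2 u by exact: filterI U1w U2w.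
  apply: near_mono2 UU sG => u [U1u U2u] sGu.
  have gE i : g i u = \sum_l s l u * G u l i.
    have /rowP/(_ i) := sGu; rewrite !mxE => <-.
    by apply: eq_bigr => l _; rewrite mxE.
  have : dot f (\sum_l Num.conj (s l u) *: D l u) = 0.
    rewrite /D; under eq_bigr do rewrite scalerBr.
    rewrite sumrB -KEs//.
    under eq_bigr do rewrite scaler_sumr.
    rewrite exchange_big /= (KEg u U2u) -sumrB big1 ?linear0r// => i _.
    rewrite gE rmorph_sum scaler_suml -sumrB big1// => l _.
    by rewrite scalerA rmorphM subrr.
  rewrite dot_sumr => rel0; rewrite -[RHS]rel0; apply: eq_bigr => l _.
  by rewrite dotZr conjCK aE mulrC.
have := minimal_generators_relation Ss ha rel j.
by rewrite aE => /dot_eq0 /eqP; rewrite subr_eq0 => /eqP.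
Qed.

Lemma gram_combination e d (v : 'I_d -> V) (G : 'M[C]_(e, d)) :
  gram dot (fun j => \sum_i Num.conj (G j i) *: v i) =
  map_mx Num.conj G *m gram dot v *m G^T.
Proof.
apply/matrixP => j l; rewrite mxE [RHS]mxE dot_sumr; apply: eq_bigr => i _.
rewrite dotZr conjCK !mxE mulrC dot_suml; congr (_ * _).
by apply: eq_bigr => k _; rewrite dotZl !mxE.
Qed.

Theorem gram_change S w e d (s : 'I_e -> fn) (g : 'I_d -> fn)
    (Ks : 'I_e -> Cm -> V) (Kg : 'I_d -> Cm -> V) (K : Cm -> V)
    (U1 U2 : set Cm) (G : Cm -> 'M[C]_(e, d)) :
  minimal_generators S w s -> open_nbhs w U1 -> open_nbhs w U2 ->
  (forall i, antiholomorphic U1 (Ks i)) -> (forall i, antiholomorphic U2 (Kg i)) ->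
  (forall u, U1 u -> K u = \sum_i Num.conj (s i u) *: Ks i u) ->
  (forall u, U2 u -> K u = \sum_i Num.conj (g i u) *: Kg i u) ->
  (forall j i, holomorphic_near w (fun u => G u j i)) ->
  (\forall u \near w, (\row_j s j u) *m G u = \row_i g i u) ->
  map_mx Num.conj (G w) *m gram dot (Kg ^~ w) *m (G w)^T = gram dot (Ks ^~ w).
Proof.
move=> Ss n1 n2 a1 a2 E1 E2 hG sG.
rewrite -gram_combination; congr (gram dot _); apply/funext => j.
by rewrite (decomposition_change Ss n1 n2 a1 a2 E1 E2 hG sG j).
Qed.

(** Orthogonality of a to the kernel of G^T for P^-1 means that a P^-1 vanishes on
    the kernel of conj G, hence that it lies in the row space of conj G. So
    a = x (conj G) P and a G^T = x Q, and both sides become x Q y^*. *)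
Lemma quotient_form e d (P : 'M[C]_d) (Q : 'M[C]_e) (G : 'M[C]_(e, d))
    (a b : 'rV[C]_d) :
  posdef P -> posdef Q -> map_mx Num.conj G *m P *m G^T = Q ->
  (forall c : 'rV[C]_d, c *m G^T = 0 -> form Num.conj (invmx P) a c = 0) ->
  (forall c : 'rV[C]_d, c *m G^T = 0 -> form Num.conj (invmx P) b c = 0) ->
  form Num.conj (invmx Q) (a *m G^T) (b *m G^T) = form Num.conj (invmx P) a b.
Proof.
move=> hP hQ PQ ha hb.
have uP := posdef_unitmx hP; have uQ := posdef_unitmx hQ.
have aP := posdef_adj hP; have aQ := posdef_adj hQ.
have aG : adj (map_mx Num.conj G) = G^T.
  by apply/matrixP => i j; rewrite !mxE conjCK.
have lift (x : 'rV[C]_d) :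
    (forall c : 'rV[C]_d, c *m G^T = 0 -> form Num.conj (invmx P) x c = 0) ->
    exists y : 'rV[C]_e, x = y *m map_mx Num.conj G *m P.
  move=> hx; suff /submxP[y hy] : (x *m invmx P <= map_mx Num.conj G)%MS.
    by exists y; rewrite -hy mulmxKV.
  set Z := cokermx (map_mx Num.conj G); rewrite submxE -/Z.
  have GZ : adj Z *m G^T = 0.
    rewrite -aG -adjM mulmx_coker.
    by apply/matrixP => i j; rewrite !mxE rmorph0.
  clearbody Z; apply/eqP/rowP => j; rewrite [RHS]mxE.
  have := hx (row j (adj Z)); rewrite -row_mul GZ row0 => /(_ erefl) h0.
  rewrite -[RHS]h0.
  rewrite /form mxE [RHS]mxE; apply: eq_bigr => k _; congr (_ * _).
  by rewrite !mxE; exact: esym (conjCK _).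
have [x ->] := lift a ha; have [y ->] := lift b hb.
have E (t : 'rV[C]_e) : t *m map_mx Num.conj G *m P *m G^T = t *m Q.
  by rewrite -!mulmxA -PQ !mulmxA.
rewrite !E /form !mulmxK// !adjM aQ aP aG !mulmxA; congr (_ 0 0).
by rewrite E.
Qed.

(** The inner product [P] on C^e carried over to the fibre at [w] by the coordinates
    that the minimal generators [s] provide. *)
Section FibreInnerProduct.
Context (S : Cm -> set fn) (w : Cm) (e : nat) (s : 'I_e -> fn).
Context (Ss : minimal_generators S w s) (P : 'M[C]_e) (hP : posdef P).
Context (h : fn -> fn -> C).
Context (hE : forall (a b : 'I_e -> fn) (f1 f2 : fn),
  (forall i, holomorphic_near w (a i)) -> (forall i, holomorphic_near w (b i)) ->
  (\forall u \near w, f1 u = \sum_i a i u * s i u) ->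
  (\forall u \near w, f2 u = \sum_i b i u * s i u) ->
  h f1 f2 = form Num.conj P (\row_i a i w) (\row_i b i w)).

Lemma coordinates_fibre_inner_product : fibre_inner_product S w h.
Proof.
split.
- move=> c f g k /(minimal_generators_coefs Ss)[a ha fE]
    /(minimal_generators_coefs Ss)[b hb gE] /(minimal_generators_coefs Ss)[t ht kE].
  rewrite (hE ha ht fE kE) (hE hb ht gE kE).
  rewrite (@hE (fun i u => c * a i u + b i u) t _ k _ ht _ kE).
  + rewrite -formZl -formDl; set x := (\row_i _); set y := (X in _ = form _ _ X _).
    by have -> : x = y by apply/rowP => i; rewrite !mxE.
  + by move=> i; apply: holo_nearD (hb i); exact: (holo_nearM (holo_near_cst w c) (ha i)).
  + apply: near_mono2 fE gE => u -> ->; rewrite mulr_sumr -big_split /=.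
    by apply: eq_bigr => i _; ring.
- move=> f g /(minimal_generators_coefs Ss)[a ha fE]
    /(minimal_generators_coefs Ss)[b hb gE].
  by rewrite (hE ha hb fE gE) (hE hb ha gE fE) hP.1.
- move=> f g fm /(minimal_generators_coefs Ss)[b hb gE].
  have Sf : S w f.
    case: fm => n [a [t [ha ht fE]]]; rewrite Ss.1.
    have htr i : germ_ideal w (range s) (t i) by rewrite -Ss.1.
    have [c hc tE] := germ_ideal_coefs htr.
    have [h1 h2] := germ_combination (fun i => (ha i).1) hc tE fE.
    by apply/germ_ideal_range; eexists; [exact: h1|exact: h2].
  have [a ha fE] := minimal_generators_coefs Ss Sf.
  have a0 := (max_ideal_mul_coefs Ss ha fE).1 fm.
  rewrite (hE ha hb fE gE) (_ : \row_i a i w = 0) ?form0l//.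
  by apply/rowP => i; rewrite !mxE a0.
- move=> f /(minimal_generators_coefs Ss)[a ha fE] nm.
  rewrite (hE ha ha fE fE); apply: hP.2; apply/eqP => a0; apply: nm.
  apply/(max_ideal_mul_coefs Ss ha fE) => i.
  by move/rowP: a0 => /(_ i); rewrite !mxE.
Qed.

Lemma coordinates_quotient d (g : 'I_d -> fn) (Q : 'M[C]_d)
    (G : Cm -> 'M[C]_(e, d)) : posdef Q ->
  (forall j i, holomorphic_near w (fun u => G u j i)) ->
  (\forall u \near w, (\row_j s j u) *m G u = \row_i g i u) ->
  map_mx Num.conj (G w) *m Q *m (G w)^T = invmx P ->
  quotient_inner_product S w g (invmx Q) h.
Proof.
move=> hQ hG sG QP.
pose coef (c : 'rV[C]_d) j u := \sum_i c 0 i * G u j i.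
have hcoef c j : holomorphic_near w (coef c j).
  apply: holo_near_sum => i _; exact: (holo_nearM (holo_near_cst w _) (hG j i)).
have coefE c : \forall u \near w, presentation g c u = \sum_j coef c j u * s j u.
  apply: near_mono sG => u sGu; rewrite /presentation /coef.
  under [RHS]eq_bigr do rewrite mulr_suml.
  rewrite exchange_big /=; apply: eq_bigr => i _.
  have /rowP/(_ i) := sGu; rewrite !mxE => <-.
  by rewrite mulr_sumr; apply: eq_bigr => j _; rewrite mxE; ring.
have rowE c : \row_j coef c j w = c *m (G w)^T.
  by apply/rowP => j; rewrite !mxE; apply: eq_bigr => i _; rewrite mxE.
have ker c : c *m (G w)^T = 0 -> max_ideal_mul w (S w) (presentation g c).
  move=> c0; apply/(max_ideal_mul_coefs Ss (hcoef c) (coefE c)) => j.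
  by have /rowP/(_ j) := rowE c; rewrite c0 !mxE.
have uP := posdef_unitmx hP.
move=> a b ha hb.
rewrite (hE (hcoef a) (hcoef b) (coefE a) (coefE b)) !rowE.
rewrite -[P in LHS]invmxK.
apply: (quotient_form hQ (posdef_invmx hP) QP).
- by move=> c /ker; exact: ha.
- by move=> c /ker; exact: hb.
Qed.

End FibreInnerProduct.
End KernelDecompositions.

Theorem theorem3p2 (R : realType) (m : nat) (Omega : set 'rV[R[i]]_m)
    (V : completeNormedModType R[i]) (dot : {dot V for @Num.conj R[i]})
    (ev : V -> 'rV[R[i]]_m -> R[i])
    (I : set (mpoly.mpoly m R[i])) (M : set V) (K : 'rV[R[i]]_m -> V)
    (h : 'rV[R[i]]_m -> ('rV[R[i]]_m -> R[i]) -> ('rV[R[i]]_m -> R[i]) -> R[i]) :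
  bounded_domain Omega ->
  analytic_hilbert_module dot ev Omega ->
  poly_ideal I ->
  M = ideal_closure ev Omega I ->
  reproducing_kernel dot ev Omega M K ->
  coherent Omega (module_sheaf ev M) ->
  canonical_hermitian dot ev Omega M K h ->
  holomorphic_hermitian_sheaf Omega (module_sheaf ev M) h /\
  (forall (w0 : 'rV[R[i]]_m) (Omega0 : set 'rV[R[i]]_m) (d : nat)
      (g0 : 'I_d -> 'rV[R[i]]_m -> R[i]) (K0 : 'I_d -> 'rV[R[i]]_m -> V),
    Omega w0 ->
    open_nbhs w0 Omega0 -> Omega0 `<=` Omega ->
    minimal_generators (module_sheaf ev M) w0 g0 ->
    (forall w, Omega0 w -> generators (module_sheaf ev M) w g0) ->
    kernel_decomposition M K Omega0 g0 K0 ->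
    forall (w : 'rV[R[i]]_m) (U : set 'rV[R[i]]_m) (e : nat)
      (s : 'I_e -> 'rV[R[i]]_m -> R[i]) (Kw : 'I_e -> 'rV[R[i]]_m -> V)
      (G : 'rV[R[i]]_m -> 'M[R[i]]_(e, d)),
    Omega0 w ->
    open_nbhs w U -> U `<=` Omega ->
    minimal_generators (module_sheaf ev M) w s ->
    kernel_decomposition M K U s Kw ->
    (forall j i, holomorphic_near w (fun u => G u j i)) ->
    (\forall u \near w, (\row_j s j u) *m G u = \row_i g0 i u) ->
    map_mx Num.conj (G w) *m gram dot (K0 ^~ w) *m (G w)^T
      = gram dot (Kw ^~ w)).
Proof.
move=> _ ahm _ _ _ coh can.
have norm_dot := ahm_norm ahm.
split; last first.
  move=> w0 Omega0 d g0 K0 _ [oOmega0 _] _ _ _ [_ aK0 _ _ K0E].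
  move=> w U e s Kw G Omega0w wU _ mins [_ aKw _ _ KwE] hG sG.
  exact: (gram_change norm_dot mins wU (conj oOmega0 Omega0w) aKw aK0 KwE K0E hG sG).
split=> //.
  move=> w Ow; have [U [d [g [Kd [[[oU Uw] _] ming [_ _ _ free _] hE]]]]] := can w Ow.
  apply: (coordinates_fibre_inner_product ming _ hE).
  by apply: posdef_invmx; apply: posdef_gram; exact: free.
move=> w0 Ow0.
have [U [d [g [Kd [[[oU Uw0] UO] ming [hg aKd _ free KE] _]]]]] := can w0 Ow0.
have [U1 [p [t [[oU1 U1w0] U1O _ gent]]]] := coh.1 w0 Ow0.
have gen1 : \forall w \near w0, generators (module_sheaf ev M) w t.
  by apply: near_mono (open_nbhs_nbhs (conj oU1 U1w0)) => w; exact: gent.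
have gen2 : \forall w \near w0, U w /\ generators (module_sheaf ev M) w g.
  apply: near_mono2 (open_nbhs_nbhs (conj oU Uw0)) (generators_near ming.1 gen1).
  by move=> w.
pose U' := (interior [set w | U w /\ generators (module_sheaf ev M) w g])%classic.
have oU' : open U' by exact: open_interior.
have U'P w : U' w -> U w /\ generators (module_sheaf ev M) w g.
  by move=> /nbhs_singleton.
exists U', d, g, (fun w => invmx (gram dot (Kd ^~ w))); split.
- by split=> // w /U'P[/UO].
- move=> i; split=> [z /U'P[Uz _]|w /U'P[_ Sg]]; first exact: hg.
  by rewrite Sg; exact: germ_ideal_gen.
- by move=> w /U'P[].
- apply: (smooth_invmx_gram norm_dot oU').
    by move=> i z /U'P[Uz _]; exact: aKd.
  by move=> u /U'P[Uu _]; exact: free.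
move=> w U'w; have [Uw Sg] := U'P w U'w.
have Pw : posdef (gram dot (Kd ^~ w)) by apply: posdef_gram; exact: free.
split; first exact: posdef_invmx.
have [U2 [e [s [Ks [[U2w U2O] mins [_ aKs _ frees KsE] hE]]]]] := can w (UO _ Uw).
have [c hc gE] : exists2 c : 'I_d -> 'I_e -> 'rV[R[i]]_m -> R[i],
    forall i j, holomorphic_near w (c i j) &
    \forall u \near w, forall i, g i u = \sum_j c i j u * s j u.
  by apply: germ_ideal_coefs => i; rewrite -mins.1 Sg; exact: germ_ideal_gen.
pose G u := \matrix_(j < e, i < d) c i j u.
have hG j i : holomorphic_near w (fun u => G u j i).
  rewrite (_ : (fun u => G u j i) = c i j); first exact: hc.
  by apply/funext => u; rewrite mxE.
have sG : \forall u \near w, (\row_j s j u) *m G u = \row_i g i u.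
  apply: near_mono gE => u gE; apply/rowP => i; rewrite !mxE gE.
  by apply: eq_bigr => j _; rewrite !mxE mulrC.
have Ps : posdef (gram dot (Ks ^~ w)).
  by apply: posdef_gram; apply: frees; exact: U2w.2.
apply: (coordinates_quotient mins (posdef_invmx Ps) hE Pw hG sG).
rewrite invmxK.
exact: (gram_change norm_dot mins U2w (conj oU Uw) aKs aKd KsE KE hG sG).
Qed.
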